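(* Let $n\geq 2$. (a) The virtual pure braid group $VP_n$ is a characteristic subgroup of the virtual braid group $VB_n$ if and only if $n\geq 4$, and the group $KB_n$ is a characteristic subgroup of $VB_n$ if and only if $n\geq 3$. (b) The welded pure braid group $WP_n$ is a characteristic subgroup of the welded braid group $WB_n$ if and only if $n\geq 3$. (c) The unrestricted virtual pure braid group $UVP_n$ is a characteristic subgroup of the unrestricted virtual braid group $UVB_n$ if and only if $n\geq 3$.
   Context: For $n\ge 2$, the virtual braid group $VB_n$ is the group generated by $\sigma_i,v_i$ ($1\le i\le n-1$) with relations: $\sigma_i\sigma_{i+1}\sigma_i=\sigma_{i+1}\sigma_i\sigma_{i+1}$ ($1\le i\le n-2$); $\sigma_i\sigma_j=\sigma_j\sigma_i$ ($|i-j|\ge2$); $v_iv_{i+1}v_i=v_{i+1}v_iv_{i+1}$ ($1\le i\le n-2$); $v_iv_j=v_jv_i$ ($|i-j|\ge 2$); $v_i^2=1$ ($1\le i\le n-1$); $\sigma_iv_j=v_j\sigma_i$ ($|i-j|\ge 2$); $v_iv_{i+1}\sigma_i=\sigma_{i+1}v_iv_{i+1}$ ($1\le i\le n-2$). The welded braid group $WB_n$ is the quotient of $VB_n$ obtained by adding the relations $v_i\sigma_{i+1}\sigma_i=\sigma_{i+1}\sigma_iv_{i+1}$ ($1\le i\le n-2$). The unrestricted virtual braid group $UVB_n$ is the quotient of $VB_n$ obtained by adding both the relations $v_i\sigma_{i+1}\sigma_i=\sigma_{i+1}\sigma_iv_{i+1}$ and $v_{i+1}\sigma_i\sigma_{i+1}=\sigma_i\sigma_{i+1}v_i$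 ($1\le i\le n-2$). Let $\tau_i=(i,i+1)\in S_n$. The homomorphisms $\pi_P,\pi_K\colon VB_n\to S_n$ are given by $\pi_P(\sigma_i)=\pi_P(v_i)=\tau_i$, and $\pi_K(\sigma_i)=1$, $\pi_K(v_i)=\tau_i$. Put $VP_n=\mathrm{Ker}(\pi_P)$ and $KB_n=\mathrm{Ker}(\pi_K)$. The map $\pi_P$ induces homomorphisms $WB_n\to S_n$ and $UVB_n\to S_n$, whose kernels are $WP_n$ and $UVP_n$ respectively. A subgroup $K$ of $G$ is characteristic if $\varphi(K)=K$ for every automorphism $\varphi$ of $G$. *)

(* Defs.v *)
From HB Require Import structures.
From mathcomp Require Import all_boot all_fingroup.
From mathcomp Require Import boolp classical_sets.

Set Implicit Arguments.
Unset Strict Implicit.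
Unset Printing Implicit Defensive.

Local Open Scope group_scope.
Local Open Scope quotient_scope.

(* A letter (x, b) stands for x when b = false and for x^-1 when b = true. *)
Definition word (X : Type) : Type := seq (X * bool).

Definition pos_word (X : Type) (s : seq X) : word X :=
  [seq (x, false) | x <- s].

Definition inv_word (X : Type) (w : word X) : word X :=
  rev [seq (a.1, ~~ a.2) | a <- w].

(* The least congruence on words containing free cancellation and R. *)
Inductive pres_eq (X : Type) (R : word X -> word X -> Prop) :
    word X -> word X -> Prop :=
| pres_eq_rel u v : R u v -> pres_eq R u v
| pres_eq_cancel x b : pres_eq R [:: (x, b); (x, ~~ b)] [::]
| pres_eq_cat u u' w w' :
    pres_eq R u u' -> pres_eq R w w' -> pres_eq R (u ++ w) (u' ++ w')
| pres_eq_refl u : pres_eq R u u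
| pres_eq_sym u v : pres_eq R u v -> pres_eq R v u
| pres_eq_trans u v w : pres_eq R u v -> pres_eq R v w -> pres_eq R u w.

Section PresentedGroup.
Variables (X : choiceType) (R : word X -> word X -> Prop).

Definition pres_eqb : rel (word X) := fun u v => `[< pres_eq R u v >].

Lemma pres_eqb_refl : reflexive pres_eqb.
Proof. by move=> u; apply/asboolP; apply: pres_eq_refl. Qed.

Lemma pres_eqb_sym : symmetric pres_eqb.
Proof.
by move=> u v; apply/idP/idP => /asboolP e; apply/asboolP; apply: pres_eq_sym.
Qed.

Lemma pres_eqb_trans : transitive pres_eqb.
Proof.
move=> v u w /asboolP e1 /asboolP e2; apply/asboolP.
exact: pres_eq_trans e1 e2.
Qed.

Canonical pres_equiv :=
  EquivRel pres_eqb pres_eqb_refl pres_eqb_sym pres_eqb_trans.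

(* The group presented by < X | u = v for R u v >. *)
Definition presented : Type := {eq_quot pres_equiv}.

HB.instance Definition _ := Choice.on presented.

Definition pres_class (w : word X) : presented := \pi_{eq_quot pres_equiv} w.

Definition pres_repr (x : presented) : word X := generic_quotient.repr (x : {eq_quot pres_equiv}).

Definition pres_gen (x : X) : presented := pres_class (pos_word [:: x]).

Lemma pres_reprK x : pres_class (pres_repr x) = x.
Proof. exact: reprK. Qed.

Lemma pres_classP u v : pres_class u = pres_class v <-> pres_eq R u v.
Proof.
split => [/eqmodP /asboolP //| e].
by apply/eqmodP; apply/asboolP.
Qed.

Lemma pres_repr_class w : pres_eq R (pres_repr (pres_class w)) w.
Proof. by apply/pres_classP; rewrite pres_reprK. Qed.

Lemma pres_eq_catV w : pres_eq R (inv_word w ++ w) [::].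
Proof.
elim: w => [|[x b] w IHw]; first exact: pres_eq_refl.
rewrite /inv_word /= rev_cons -cats1 -catA /=.
apply: pres_eq_trans IHw.
apply: pres_eq_cat; first exact: pres_eq_refl.
rewrite -[_ :: _ :: w]/([:: (x, ~~ b); (x, b)] ++ w) -[X in pres_eq _ _ X]cat0s.
apply: pres_eq_cat; last exact: pres_eq_refl.
by rewrite -[in (x, b)](negbK b); apply: pres_eq_cancel.
Qed.

Lemma inv_wordK : involutive (@inv_word X).
Proof.
move=> w; rewrite /inv_word map_rev revK -map_comp -[RHS]map_id.
by apply: eq_map => -[x b] /=; rewrite negbK.
Qed.

Lemma inv_word_cat (u v : word X) :
  inv_word (u ++ v) = inv_word v ++ inv_word u.
Proof. by rewrite /inv_word map_cat rev_cat. Qed.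

Lemma pres_eq_inv u v : pres_eq R u v -> pres_eq R (inv_word u) (inv_word v).
Proof.
move=> e.
have eV : pres_eq R (v ++ inv_word v) [::].
  by have := pres_eq_catV (inv_word v); rewrite inv_wordK.
apply: pres_eq_trans (_ : pres_eq R (inv_word u ++ (v ++ inv_word v)) _).
  rewrite -[X in pres_eq _ X _]cats0.
  by apply: pres_eq_cat; [exact: pres_eq_refl|exact: pres_eq_sym].
rewrite catA -[X in pres_eq _ _ X]cat0s.
apply: pres_eq_cat; last exact: pres_eq_refl.
apply: pres_eq_trans (pres_eq_catV u).
by apply: pres_eq_cat; [exact: pres_eq_refl|exact: pres_eq_sym].
Qed.

Definition pres_one : presented := pres_class [::].
Definition pres_mul (x y : presented) : presented :=
  pres_class (pres_repr x ++ pres_repr y).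
Definition pres_inv (x : presented) : presented :=
  pres_class (inv_word (pres_repr x)).

Lemma pres_class_cat u v :
  pres_mul (pres_class u) (pres_class v) = pres_class (u ++ v).
Proof. by apply/pres_classP; apply: pres_eq_cat; apply: pres_repr_class. Qed.

Lemma pres_class_inv u : pres_inv (pres_class u) = pres_class (inv_word u).
Proof. by apply/pres_classP; apply: pres_eq_inv; apply: pres_repr_class. Qed.

Lemma pres_mulA : associative pres_mul.
Proof.
move=> x y z; rewrite -(pres_reprK x) -(pres_reprK y) -(pres_reprK z).
by rewrite !pres_class_cat catA.
Qed.

Lemma pres_mul1 : left_id pres_one pres_mul.
Proof. by move=> x; rewrite -(pres_reprK x) pres_class_cat. Qed.

Lemma pres_mulr1 : right_id pres_one pres_mul.
Proof. by move=> x; rewrite -(pres_reprK x) pres_class_cat cats0. Qed.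

Lemma pres_mulV : left_inverse pres_one pres_inv pres_mul.
Proof.
move=> x; rewrite -(pres_reprK x) pres_class_inv pres_class_cat.
by apply/pres_classP; apply: pres_eq_catV.
Qed.

Lemma pres_mulrV : right_inverse pres_one pres_inv pres_mul.
Proof.
move=> x; rewrite -(pres_reprK x) pres_class_inv pres_class_cat.
apply/pres_classP; rewrite -{1}(inv_wordK (pres_repr x)).
exact: pres_eq_catV.
Qed.

HB.instance Definition _ := isGroup.Build presented
  pres_mulA pres_mul1 pres_mulr1 pres_mulV pres_mulrV.

Lemma pres_classM u v : pres_class (u ++ v) = pres_class u * pres_class v.
Proof. by rewrite -pres_class_cat. Qed.

Lemma pres_classV u : pres_class (inv_word u) = (pres_class u)^-1.
Proof. by rewrite -pres_class_inv. Qed.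

End PresentedGroup.

Definition word_eval (X : Type) (G : groupType) (f : X -> G) (w : word X) : G :=
  \prod_(a <- w) (if a.2 then (f a.1)^-1 else f a.1).

(* This is the homomorphism extending f as soon as f respects R; see
   pres_liftM and pres_lift_gen. *)
Definition pres_lift (X : choiceType) (R : word X -> word X -> Prop)
    (G : groupType) (f : X -> G) (x : presented R) : G :=
  word_eval f (pres_repr x).

Section Lift.
Variables (X : choiceType) (R : word X -> word X -> Prop).
Variables (G : groupType) (f : X -> G).
Hypothesis fR : forall u v, R u v -> word_eval f u = word_eval f v.

Lemma word_eval_cat u v : word_eval f (u ++ v) = word_eval f u * word_eval f v.
Proof. by rewrite /word_eval big_cat. Qed.

Lemma word_eval_pres_eq u v : pres_eq R u v -> word_eval f u = word_eval f v.
Proof.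
elim=> {u v} [u v /fR //|x b|u u' w w' _ e1 _ e2|u //|u v _ -> //|].
- rewrite /word_eval !big_cons big_nil mulg1 /=.
  by case: b => /=; rewrite ?mulVg ?mulgV.
- by rewrite !word_eval_cat e1 e2.
- by move=> u v w _ -> _ ->.
Qed.

Lemma pres_lift_class w : pres_lift f (pres_class R w) = word_eval f w.
Proof. by apply: word_eval_pres_eq; apply: pres_repr_class. Qed.

Lemma pres_liftM :
  {morph (pres_lift f : presented R -> G) : x y / x * y >-> x * y}.
Proof.
move=> x y; rewrite -[x * y]/(pres_class R _) pres_lift_class.
exact: word_eval_cat.
Qed.

Lemma pres_lift_gen x : pres_lift f (pres_gen R x) = f x.
Proof. by rewrite pres_lift_class /word_eval big_seq1. Qed.

End Lift.

(* Generators of the n-strand groups. Indices are 0-based: i : 'I_n.-1 stands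
   for the index i + 1 of the usual numbering 1, ..., n - 1. *)
Definition VBgen (n : nat) : choiceType := ('I_n.-1 + 'I_n.-1)%type.
Definition sigma (n : nat) (i : 'I_n.-1) : VBgen n := inl i.
Definition virt (n : nat) (i : 'I_n.-1) : VBgen n := inr i.

Definition far (n : nat) (i j : 'I_n.-1) : bool := (i.+1 < j) || (j.+1 < i).

Inductive VB_rel (n : nat) : word (VBgen n) -> word (VBgen n) -> Prop :=
| VB_braid (i j : 'I_n.-1) : j = i.+1 :> nat ->
    VB_rel (pos_word [:: sigma i; sigma j; sigma i])
           (pos_word [:: sigma j; sigma i; sigma j])
| VB_comm (i j : 'I_n.-1) : far i j ->
    VB_rel (pos_word [:: sigma i; sigma j]) (pos_word [:: sigma j; sigma i])
| VB_vbraid (i j : 'I_n.-1) : j = i.+1 :> nat ->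
    VB_rel (pos_word [:: virt i; virt j; virt i])
           (pos_word [:: virt j; virt i; virt j])
| VB_vcomm (i j : 'I_n.-1) : far i j ->
    VB_rel (pos_word [:: virt i; virt j]) (pos_word [:: virt j; virt i])
| VB_vinvol (i : 'I_n.-1) :
    VB_rel (pos_word [:: virt i; virt i]) [::]
| VB_mcomm (i j : 'I_n.-1) : far i j ->
    VB_rel (pos_word [:: sigma i; virt j]) (pos_word [:: virt j; sigma i])
| VB_mixed (i j : 'I_n.-1) : j = i.+1 :> nat ->
    VB_rel (pos_word [:: virt i; virt j; sigma i])
           (pos_word [:: sigma j; virt i; virt j]).

Inductive WB_rel (n : nat) : word (VBgen n) -> word (VBgen n) -> Prop :=
| WB_VB u w : VB_rel u w -> WB_rel u w
| WB_forbidden (i j : 'I_n.-1) : j = i.+1 :> nat ->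
    WB_rel (pos_word [:: virt i; sigma j; sigma i])
           (pos_word [:: sigma j; sigma i; virt j]).

Inductive UVB_rel (n : nat) : word (VBgen n) -> word (VBgen n) -> Prop :=
| UVB_WB u w : WB_rel u w -> UVB_rel u w
| UVB_forbidden (i j : 'I_n.-1) : j = i.+1 :> nat ->
    UVB_rel (pos_word [:: virt j; sigma i; sigma j])
            (pos_word [:: sigma i; sigma j; virt i]).

Definition VB (n : nat) : groupType := presented (@VB_rel n).
Definition WB (n : nat) : groupType := presented (@WB_rel n).
Definition UVB (n : nat) : groupType := presented (@UVB_rel n).

Lemma strand_subproof (n : nat) (i : 'I_n.-1) : i.+1 < n.
Proof. by rewrite -ltn_predRL. Qed.

Definition strand_lo (n : nat) (i : 'I_n.-1) : 'I_n :=
  Ordinal (ltnW (strand_subproof i)).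
Definition strand_hi (n : nat) (i : 'I_n.-1) : 'I_n :=
  Ordinal (strand_subproof i).

(* Permutations compose from left to right here. The opposite convention gives
   the same kernels below: reversing a product of transpositions inverts it. *)
Definition tau (n : nat) (i : 'I_n.-1) : 'S_n :=
  tperm (strand_lo i) (strand_hi i).

Definition genP (n : nat) (g : VBgen n) : 'S_n :=
  match g with inl i => tau i | inr i => tau i end.
Definition genK (n : nat) (g : VBgen n) : 'S_n :=
  match g with inl _ => 1 | inr i => tau i end.

Definition piP (n : nat) : VB n -> 'S_n := pres_lift (@genP n).
Definition piK (n : nat) : VB n -> 'S_n := pres_lift (@genK n).
Definition piPW (n : nat) : WB n -> 'S_n := pres_lift (@genP n).
Definition piPU (n : nat) : UVB n -> 'S_n := pres_lift (@genP n).

Section TauRelations.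
Variable n : nat.
Implicit Types i j : 'I_n.-1.

Lemma tau2 i : tau i * tau i = 1.
Proof. exact: tperm2. Qed.

Lemma tau_braid i j :
  j = i.+1 :> nat -> tau i * tau j * tau i = tau j * tau i * tau j.
Proof.
move=> eij.
have lo_hi : strand_lo j = strand_hi i by apply: val_inj.
have ne1 : strand_lo i != strand_hi i by rewrite -val_eqE /= neq_ltn leqnn.
have ne2 : strand_lo i != strand_hi j.
  by rewrite -val_eqE /= eij neq_ltn leqnSn.
have ne3 : strand_hi i != strand_hi j by rewrite -val_eqE /= eij neq_ltn leqnn.
rewrite /tau lo_hi.
set a := strand_lo i in ne1 ne2 *; set b := strand_hi i in ne1 ne3 *.
set c := strand_hi j in ne2 ne3 *.
have -> : tperm a b * tperm b c * tperm a b = tperm b c ^ tperm a b.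
  by rewrite conjgE tpermV mulgA.
have -> : tperm b c * tperm a b * tperm b c = tperm a b ^ tperm b c.
  by rewrite conjgE tpermV mulgA.
by rewrite !tpermJ tpermR tpermL !tpermD // eq_sym.
Qed.

Lemma tau_comm i j : far i j -> tau i * tau j = tau j * tau i.
Proof.
move=> fij; apply/commgP/conjg_fixP; rewrite tpermJ.
have ne : [/\ strand_lo j != strand_lo i, strand_hi j != strand_lo i,
              strand_lo j != strand_hi i & strand_hi j != strand_hi i].
  rewrite -!val_eqE /= !eqSS !neq_ltn.
  by case/orP: fij => lt_ij; split; apply/orP;
    [right|right|right|right|left|left|left|left];
    do ?[exact: lt_ij | apply: ltnW].
by case: ne => *; rewrite !tpermD.
Qed.

Lemma genP_UVB u w :
  UVB_rel u w -> word_eval (@genP n) u = word_eval (@genP n) w.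
Proof.
rewrite /word_eval.
case=> {u w} [u w|i j /tau_braid e]; last first.
  by rewrite !big_cons !big_nil /= !mulg1 !mulgA -e.
case=> {u w} [u w|i j /tau_braid e]; last first.
  by rewrite !big_cons !big_nil /= !mulg1 !mulgA e.
by case=> {u w} [i j /tau_braid e|i j /tau_comm e|i j /tau_braid e
  |i j /tau_comm e|i|i j /tau_comm e|i j /tau_braid e];
  rewrite !big_cons !big_nil /= !mulg1 ?mulgA ?tau2 ?e.
Qed.

Lemma genP_WB u w :
  WB_rel u w -> word_eval (@genP n) u = word_eval (@genP n) w.
Proof. by move=> r; apply/genP_UVB/UVB_WB. Qed.

Lemma genP_VB u w :
  VB_rel u w -> word_eval (@genP n) u = word_eval (@genP n) w.
Proof. by move=> r; apply/genP_WB/WB_VB. Qed.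

Lemma genK_VB u w :
  VB_rel u w -> word_eval (@genK n) u = word_eval (@genK n) w.
Proof.
rewrite /word_eval.
by case=> {u w} [i j _|i j _|i j /tau_braid e
  |i j /tau_comm e|i|i j _|i j _];
  rewrite !big_cons !big_nil /= ?mulg1 ?mul1g ?mulgA ?tau2 ?e.
Qed.

Lemma piP_gen g : piP (pres_gen (@VB_rel n) g) = genP g.
Proof. exact: (pres_lift_gen genP_VB). Qed.
Lemma piK_gen g : piK (pres_gen (@VB_rel n) g) = genK g.
Proof. exact: (pres_lift_gen genK_VB). Qed.
Lemma piPW_gen g : piPW (pres_gen (@WB_rel n) g) = genP g.
Proof. exact: (pres_lift_gen genP_WB). Qed.
Lemma piPU_gen g : piPU (pres_gen (@UVB_rel n) g) = genP g.
Proof. exact: (pres_lift_gen genP_UVB). Qed.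

(* piPW and piPU are the maps induced by piP on the quotients WB and UVB. *)
Lemma piPW_class w : piPW (pres_class (@WB_rel n) w) = piP (pres_class _ w).
Proof.
by rewrite /piPW /piP (pres_lift_class genP_WB) (pres_lift_class genP_VB).
Qed.
Lemma piPU_class w : piPU (pres_class (@UVB_rel n) w) = piP (pres_class _ w).
Proof.
by rewrite /piPU /piP (pres_lift_class genP_UVB) (pres_lift_class genP_VB).
Qed.

HB.instance Definition _ :=
  isMultiplicative.Build (VB n) 'S_n (@piP n) (pres_liftM genP_VB).
HB.instance Definition _ :=
  isMultiplicative.Build (VB n) 'S_n (@piK n) (pres_liftM genK_VB).
HB.instance Definition _ :=
  isMultiplicative.Build (WB n) 'S_n (@piPW n) (pres_liftM genP_WB).
HB.instance Definition _ :=
  isMultiplicative.Build (UVB n) 'S_n (@piPU n) (pres_liftM genP_UVB).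

End TauRelations.

Local Open Scope classical_set_scope.

Definition group_kernel (G H : groupType) (f : {multiplicative G -> H}) :
  set G := [set x | f x = 1].

Definition VP (n : nat) : set (VB n) := group_kernel (@piP n).
Definition KB (n : nat) : set (VB n) := group_kernel (@piK n).
Definition WP (n : nat) : set (WB n) := group_kernel (@piPW n).
Definition UVP (n : nat) : set (UVB n) := group_kernel (@piPU n).

Arguments VP : clear implicits.
Arguments KB : clear implicits.
Arguments WP : clear implicits.
Arguments UVP : clear implicits.

Definition is_characteristic (G : groupType) (K : set G) : Prop :=
  forall phi : {multiplicative G -> G}, bijective phi -> phi @` K = K.

(* Main.v *)
Require Import Defs.
From HB Require Import structures.
From mathcomp Require Import boolp classical_sets.
From mathcomp Require Import all_boot all_fingroup all_solvable all_order all_algebra.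
From mathcomp Require Import zify lra.

(** Composing the projection onto S_n with an automorphism gives another
    surjection f onto S_n, and the kernel of the projection is characteristic when
    f always kills it. For n >= 5, the v_i generate a copy of S_n (Coxeter
    presentation) on which f is injective because Alt_n is simple; since
    sigma_1 commutes with v_3, ..., v_(n-1), this forces f(sigma_i) to be 1 for all
    i or f(v_i) for all i, so that f has the kernel of pi_K or of pi_P. For
    n = 3, 4 the surjections are enumerated, and a few more kernels occur.

    Two invariants separate the kernels K. First, [G, G] acts trivially on
    K / [K, K] when K = KB_n, but not for the other kernels in
    VB_n: this is detected by lifting f to an extension by an abelian group,
    namely Z^n (strand weights) for pi_P, and the Klein four-group for n = 3, 4.
    Second, the space of cocycles G -> Q^n, with G acting through f, has dimension
    at least n + 2 for pi_P (three strand weights and the coboundaries), and at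
    most n + 1 for the additional kernels. In WB_n and UVB_n the forbidden relation
    rules out pi_K.

    For n = 2 the automorphism sigma -> sigma v, v -> v moves all the kernels. For
    n = 3, VB_3 is an amalgam over the cyclic group generated by v_1 v_2, and
    conjugating the sigma_i, but not the v_i, by v_1 v_2 moves VP_3. *)

Set Implicit Arguments.
Unset Strict Implicit.
Unset Printing Implicit Defensive.

Local Open Scope group_scope.

(** * Presented groups and the Coxeter presentation *)

Definition hom_of (G H : groupType) (h : G -> H)
    (hM : {morph h : x y / x * y}) : {multiplicative G -> H} :=
  HB.pack h (isMultiplicative.Build G H h hM).

(* The library's gmulf1 and gmulfV are stated for UMagmaMorphism, which
   {multiplicative _ -> _} does not coerce to. *)
Lemma hom1 (G H : groupType) (h : {multiplicative G -> H}) : h 1 = 1.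
Proof. by apply: (mulgI (h 1)); rewrite -gmulfM !mulg1. Qed.

Lemma homV (G H : groupType) (h : {multiplicative G -> H}) x : h x^-1 = (h x)^-1.
Proof. by apply: (mulgI (h x)); rewrite -gmulfM !mulgV hom1. Qed.

Lemma homR (G H : groupType) (h : {multiplicative G -> H}) x y :
  h [~ x, y] = [~ h x, h y].
Proof. by rewrite !commgEl !gmulfM !homV. Qed.

Lemma word_eval_gen (X : choiceType) (R : word X -> word X -> Prop) (w : word X) :
  word_eval (pres_gen R) w = pres_class R w.
Proof.
elim: w => [|[x b] w IHw]; first by rewrite /word_eval big_nil.
rewrite /word_eval big_cons -/(word_eval _ w) IHw -cat1s pres_classM /=.
by congr (_ * _); case: b => //; rewrite -pres_classV.
Qed.

Lemma gmulf_word_eval (X : Type) (G H : groupType) (h : {multiplicative G -> H})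
  (q : X -> G) (w : word X) : h (word_eval q w) = word_eval (h \o q) w.
Proof.
rewrite /word_eval (big_morph h gmulfM (hom1 h)).
by apply: eq_bigr => -[x []] _ //=; rewrite homV.
Qed.

Lemma eq_word_eval (X : Type) (G : groupType) (f g : X -> G) (w : word X) :
  f =1 g -> word_eval f w = word_eval g w.
Proof. by move=> fg; apply: eq_bigr => a _; rewrite fg. Qed.

Section PresHom.
Variables (X : choiceType) (R : word X -> word X -> Prop).

Lemma pres_hom_rel (H : groupType) (h : {multiplicative presented R -> H}) u w :
  R u w ->
  word_eval (h \o pres_gen R) u = word_eval (h \o pres_gen R) w.
Proof.
move=> uw; rewrite -!gmulf_word_eval !word_eval_gen.
by congr (h _); apply/pres_classP/pres_eq_rel.
Qed.

Lemma pres_ind (P : presented R -> Prop) :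
  P 1 ->
  (forall x g, P x -> P (x * pres_gen R g)) ->
  (forall x g, P x -> P (x * (pres_gen R g)^-1)) ->
  forall x, P x.
Proof.
move=> P1 PM PV x; rewrite -(pres_reprK x) -word_eval_gen.
elim/last_ind: (pres_repr x) => [|w [g b] IHw]; first by rewrite /word_eval big_nil.
rewrite -cats1 word_eval_cat /word_eval big_seq1 /=.
by case: b; [apply: PV|apply: PM].
Qed.

Lemma pres_hom_ext (H : groupType) (h k : {multiplicative presented R -> H}) :
  (forall g, h (pres_gen R g) = k (pres_gen R g)) -> h =1 k.
Proof.
move=> hk; apply: pres_ind => [|x g e|x g e]; first by rewrite !hom1.
  by rewrite !gmulfM e hk.
by rewrite !gmulfM !homV e hk.
Qed.

End PresHom.

Lemma inverse_hom (G : groupType) (phi : {multiplicative G -> G}) :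
  bijective phi ->
  exists2 psi : {multiplicative G -> G}, cancel phi psi & cancel psi phi.
Proof.
case=> psi phiK psiK.
by exists (hom_of (can2_gmulfM phiK psiK)).
Qed.

(** One inclusion suffices, since the inclusion for the inverse automorphism gives the other. *)
Lemma characteristic_kernelP (G H : groupType) (f : {multiplicative G -> H}) :
  is_characteristic (group_kernel f) <->
  forall phi : {multiplicative G -> G}, bijective phi ->
    forall x, f x = 1 -> f (phi x) = 1.
Proof.
split=> [chK phi bphi x fx1|chK phi bphi].
  by have : (group_kernel f) (phi x) by rewrite -(chK phi bphi); exists x.
apply/seteqP; split=> [_ [x fx1 <-]|x fx1]; first exact: chK.
have [psi phiK psiK] := inverse_hom bphi.
by exists (psi x); [apply: chK => //; exists phi|].
Qed.

(** Stated for two families in an arbitrary group, so that the relations can be used on images of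
    the generators as well as to construct homomorphisms. *)
Record vb_rels (n : nat) (G : groupType) (s v : 'I_n.-1 -> G) : Prop := VBRels {
  vb_braid : forall i j : 'I_n.-1, j = i.+1 :> nat -> s i * s j * s i = s j * s i * s j;
  vb_comm : forall i j : 'I_n.-1, far i j -> s i * s j = s j * s i;
  vb_vbraid : forall i j : 'I_n.-1, j = i.+1 :> nat -> v i * v j * v i = v j * v i * v j;
  vb_vcomm : forall i j : 'I_n.-1, far i j -> v i * v j = v j * v i;
  vb_vinvol : forall i, v i * v i = 1;
  vb_mcomm : forall i j : 'I_n.-1, far i j -> s i * v j = v j * s i;
  vb_mixed : forall i j : 'I_n.-1, j = i.+1 :> nat -> v i * v j * s i = s j * v i * v j }.

Lemma vb_relsP n (G : groupType) (q : VBgen n -> G) :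
  (forall u w, VB_rel u w -> word_eval q u = word_eval q w) <->
  vb_rels (q \o @sigma n) (q \o @virt n).
Proof.
split=> [qR|qR u w].
  by split=> [i j /VB_braid|i j /VB_comm|i j /VB_vbraid|i j /VB_vcomm|i
    |i j /VB_mcomm|i j /VB_mixed]; last 1 [idtac] || idtac;
  [ move=> /qR | move=> /qR | move=> /qR | move=> /qR
  | have /qR := VB_vinvol i | move=> /qR | move=> /qR ];
  rewrite /word_eval !big_cons ?big_nil /= ?mulg1 ?mulgA.
by case=> {u w} [i j /(vb_braid qR) e|i j /(vb_comm qR) e
  |i j /(vb_vbraid qR) e|i j /(vb_vcomm qR) e|i|i j /(vb_mcomm qR) e
  |i j /(vb_mixed qR) e]; rewrite /word_eval !big_cons ?big_nil /= ?mulg1 ?mulgA //;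
  apply: (vb_vinvol qR).
Qed.

Section Coxeter.
Variables (n : nat) (G : groupType) (p : {multiplicative G -> 'S_n}).
Variable v : 'I_n.-1 -> G.
Hypothesis v_invol : forall i, v i * v i = 1.
Hypothesis v_braid :
  forall i j : 'I_n.-1, j = i.+1 :> nat -> v i * v j * v i = v j * v i * v j.
Hypothesis v_comm : forall i j, far i j -> v i * v j = v j * v i.
Hypothesis pv : forall i, p (v i) = tau i.

Definition vprod (s : seq 'I_n.-1) : G := \prod_(i <- s) v i.

Lemma vprod_cat s t : vprod (s ++ t) = vprod s * vprod t.
Proof. exact: big_cat. Qed.

Lemma vprod_seq1 i : vprod [:: i] = v i.
Proof. exact: big_seq1. Qed.

Lemma vprod_nil : vprod [::] = 1.
Proof. exact: big_nil. Qed.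

(** Extending [v] by 1 to all natural numbers frees [desc] from bounds on its indices. *)
Let vv (k : nat) : G := if insub k is Some i then v i else 1.

Let vvE (i : 'I_n.-1) : vv i = v i.
Proof. by rewrite /vv valK. Qed.

Let vv2 k : vv k * vv k = 1.
Proof. by rewrite /vv; case: insubP => [i _ _|_]; rewrite ?mulg1. Qed.

Let vv_comm i j : i.+1 < j -> vv i * vv j = vv j * vv i.
Proof.
rewrite /vv => ij; case: insubP => [i' _ ei|_]; last by rewrite mul1g mulg1.
case: insubP => [j' _ ej|_]; last by rewrite mul1g mulg1.
by apply: v_comm; rewrite /far ei ej ij.
Qed.

Let vv_braid i : i.+1 < n.-1 -> vv i * vv i.+1 * vv i = vv i.+1 * vv i * vv i.+1.
Proof.
move=> lt_i; rewrite -[i.+1]/(val (Ordinal lt_i)) -[i]/(val (Ordinal (ltnW lt_i))).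
by rewrite !vvE; apply: v_braid.
Qed.

(* The coset representatives v_(j + l - 1) ... v_j of the parabolic subgroup
   generated by the v_i with i < j + l - 1. *)
Let Fixpoint desc (j l : nat) {struct l} : G := if l is l'.+1 then desc j.+1 l' * vv j else 1.

Let desc_comm i j l : i.+1 < j -> vv i * desc j l = desc j l * vv i.
Proof.
elim: l j => [|l IHl] j ij /=; first by rewrite mul1g mulg1.
by rewrite mulgA IHl 1?ltnW // -!mulgA vv_comm.
Qed.

(** Moving leftwards, v_i passes the letters of index below i - 1, the braid relation turns v_i
    v_(i-1) v_i into v_(i-1) v_i v_(i-1), and v_(i-1) passes the remaining letters. *)
Let desc_shift i j l : j < i -> i < j + l -> j + l <= n.-1 ->
  desc j l * vv i = vv i.-1 * desc j l.
Proof.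
elim: l j => [|l IHl] j ji; first by rewrite addn0 ltnNge ltnW.
rewrite addnS -addSn => il ln /=; rewrite -mulgA.
case: (eqVneq i j.+1) => [ei|ne]; last first.
  have ji' : j.+1 < i by rewrite ltn_neqAle eq_sym ne.
  by rewrite vv_comm // !mulgA IHl.
clear IHl; subst i; case: l il ln => [|l] il ln; first by rewrite addn0 ltnn in il.
rewrite /= -!mulgA [vv j.+1 * (_ * _)]mulgA -vv_braid; last first.
  by apply: leq_trans ln; rewrite !addnS !ltnS leq_addr.
by rewrite !mulgA desc_comm.
Qed.

Definition vparab (k : nat) (x : G) : Prop :=
  exists2 s : seq 'I_n.-1, all (fun i : 'I__ => i < k) s & x = vprod s.

Let vparab1 k : vparab k 1.
Proof. by exists [::] => //; rewrite vprod_nil. Qed.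

Let vparabM k x i : vparab k x -> i < k -> vparab k (x * vv i).
Proof.
case=> s sk -> ik; rewrite /vv; case: insubP => [i' _ ei|_]; last first.
  by rewrite mulg1; exists s.
exists (rcons s i'); first by rewrite all_rcons sk ei ik.
by rewrite -cats1 vprod_cat vprod_seq1.
Qed.

(** The set of products u * [desc] j l is stable under right multiplication by v_i: this lengthens
    the representative if i = j - 1, shortens it if i = j, and otherwise only changes u. *)
Let vparab_decomp k x : k < n.-1 -> vparab k.+1 x ->
  exists u j l, [/\ vparab k u, j + l = k.+1 & x = u * desc j l].
Proof.
move=> kn [s + ->]; elim/last_ind: s => [_|s i IHs].
  by exists 1, k.+1, 0; rewrite addn0 vprod_nil mulg1.
rewrite all_rcons -cats1 vprod_cat vprod_seq1 => /andP[ik /IHs].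
move=> [u [j [l [uk jl ->]]]]; rewrite -vvE -mulgA.
case: (ltngtP i j) => [ij|ji|eij].
- move: ij; rewrite leq_eqVlt => /predU1P[eij|ij].
    by exists u, i, l.+1; split; rewrite /= ?eij // addnS -addSn eij.
  exists (u * vv i), j, l; split=> //; last by rewrite -desc_comm ?mulgA.
  apply: vparabM => //; rewrite -ltnS; apply: leq_trans ij _.
  by rewrite -jl leq_addr.
- exists (u * vv i.-1), j, l; split=> //; last first.
    by rewrite desc_shift ?mulgA // jl.
  apply: vparabM => //; rewrite -ltnS prednK //; exact: leq_ltn_trans ji.
case: l jl => [|l] jl; first by move: ik; rewrite eij -jl addn0 ltnn.
by exists u, j.+1, l; rewrite addSn -addnS /= eij -mulgA vv2 mulg1.
Qed.

Let tau_fix (i : 'I_n.-1) (k : 'I_n) : i.+1 < k -> tau i k = k.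
Proof.
by move=> ik; rewrite tpermD // -val_eqE /= neq_ltn ?ik ?orbT // ltnW.
Qed.

Let vparab_fix k x (m : 'I_n) : vparab k x -> k < m -> p x m = m.
Proof.
case=> s + -> km; elim/last_ind: s => [|s i IHs].
  by rewrite vprod_nil hom1 perm1.
rewrite all_rcons -cats1 vprod_cat vprod_seq1 gmulfM permM.
move=> /andP[ik /IHs ->]; rewrite pv tau_fix //; exact: leq_ltn_trans km.
Qed.

Let desc_top j l (m : 'I_n) : m = j + l :> nat -> p (desc j l) m = j :> nat.
Proof.
elim: l j m => [|l IHl] j m; first by rewrite addn0 hom1 perm1.
rewrite addnS -addSn => em /=; rewrite gmulfM permM.
have jn : j < n.-1.
  by rewrite ltn_predRL; apply: leq_ltn_trans (ltn_ord m); rewrite em leq_addr.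
rewrite -[j]/(val (Ordinal jn)) vvE pv.
suff -> : p (desc (Ordinal jn).+1 l) m = strand_hi (Ordinal jn) by rewrite tpermR.
by apply: val_inj; apply: IHl.
Qed.

(** The preimage under p of a permutation meets each coset at most once: by [desc_top], the image of
    the top point k + 1 determines j. If p x = 1, the representative is therefore trivial and x lies
    in the smaller parabolic subgroup. *)
Let vparab_faithful k x : k <= n.-1 -> vparab k x -> p x = 1 -> x = 1.
Proof.
elim: k x => [|k IHk] x.
  by move=> _ [[|i s] //= _ ->]; rewrite vprod_nil.
move=> kn /(vparab_decomp kn)[u [j [l [uk jl ->]]]] px.
have kn' : k.+1 < n by rewrite -ltn_predRL.
have := desc_top (esym jl : nat_of_ord (Ordinal kn') = _).
have /(congr1 (fun s : 'S_n => s (Ordinal kn'))) := px.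
rewrite gmulfM permM (vparab_fix uk) //= perm1 => ->/= ej.
move: jl px; rewrite -ej -[RHS]addn0 => /addnI ->.
by rewrite mulg1; apply: IHk => //; apply: ltnW.
Qed.

Let vparab_surj k (g : 'S_n) : k <= n.-1 ->
  (forall m : 'I_n, k < m -> g m = m) -> exists2 x, vparab k x & p x = g.
Proof.
elim: k g => [|k IHk] g kn gfix.
  exists 1 => //; rewrite hom1; apply/permP => m; rewrite perm1.
  case: (posnP m) => [m0|/gfix //]; case: (posnP (g m)) => [gm0|/gfix /perm_inj //].
  by apply: val_inj; rewrite /= m0 gm0.
have kn' : k.+1 < n by rewrite -ltn_predRL.
pose K := Ordinal kn'.
have gK : g K <= k.+1.
  rewrite leqNgt; apply/negP => /[dup] lt_k /gfix /perm_inj e.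
  by move: lt_k; rewrite e ltnn.
have [d dE dfix] : exists2 d, p d K = g K &
    (exists2 y, vparab k.+1 y & y = d) /\ forall m : 'I_n, k.+1 < m -> p d m = m.
  pose d := desc (g K) (k.+1 - g K).
  have dk : vparab k.+1 d.
    rewrite /d; move: (nat_of_ord _) gK => j; move El: (k.+1 - j) => l jk.
    have : j + l <= k.+1 by rewrite -El subnKC.
    elim: l j {El jk} => [|l IHl] j jl //=.
    apply: vparabM; first by apply: IHl; rewrite addSn -addnS.
    by apply: leq_trans jl; rewrite addnS ltnS leq_addr.
  exists d; last by split; [exists d|move=> m; apply: vparab_fix].
  by apply: val_inj; apply: desc_top; rewrite subnKC.
case: dfix => -[_ [s sk ->] ed] dfix.
have [|m km|x xk px] := IHk (g * (p d)^-1); first exact: ltnW.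
  rewrite permM; apply: (canLR (permK _)).
  move: km; rewrite leq_eqVlt => /predU1P[ekm|km]; last by rewrite gfix ?dfix.
  by have -> : m = K by apply: val_inj.
exists (x * d); last by rewrite gmulfM px mulgKV.
case: xk => t tk ->; exists (t ++ s); last by rewrite -ed vprod_cat.
by rewrite all_cat sk andbT; apply: sub_all tk => i /ltnW.
Qed.

Let all_lt (s : seq 'I_n.-1) : all (fun i : 'I__ => i < n.-1) s.
Proof. by apply/allP => i _. Qed.

Lemma vprod_faithful s : p (vprod s) = 1 -> vprod s = 1.
Proof. by apply: (vparab_faithful (leqnn _)); exists s. Qed.

Lemma vprod_surj (g : 'S_n) : exists s, p (vprod s) = g.
Proof.
have [m|x [s _ ->] <-] := vparab_surj (leqnn n.-1) (g := g); last by exists s.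
by rewrite ltnNge -ltnS (ltn_predK (ltn_ord m)) ltn_ord.
Qed.

Lemma vprod_inj s t : p (vprod s) = p (vprod t) -> vprod s = vprod t.
Proof.
have vprodV r : vprod (rev r) = (vprod r)^-1.
  apply: (mulIg (vprod r)); rewrite mulVg -vprod_cat.
  elim: r => [|i r IHr]; first by rewrite vprod_nil.
  rewrite rev_cons -cats1 -catA vprod_cat -[[:: i] ++ _]/([:: i] ++ ([:: i] ++ r)).
  by rewrite 2!vprod_cat vprod_seq1 [v i * (v i * _)]mulgA v_invol mul1g -vprod_cat.
move=> e; apply: (mulgI (vprod s)^-1); rewrite mulVg -vprodV -vprod_cat.
by rewrite vprod_faithful // vprod_cat vprodV gmulfM homV e mulVg.
Qed.

End Coxeter.

(** * Strand weights and the action of commutators on kernels *)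

Section Affine.
Variables (A : zmodType) (n : nat).

(* The semidirect product of A^n by S_n; an element (c, p) records for each
   strand i its weight c i and its end point p i. *)
Definition affine : Type := ({ffun 'I_n -> A} * 'S_n)%type.

HB.instance Definition _ := Choice.on affine.

Definition affine_one : affine := ([ffun=> 0%R], 1).
Definition affine_mul (x y : affine) : affine :=
  ([ffun i => (x.1 i + y.1 (x.2 i))%R], x.2 * y.2).
Definition affine_inv (x : affine) : affine :=
  ([ffun i => (- x.1 (x.2^-1%g i))%R], x.2^-1).

Lemma affine_mulA : associative affine_mul.
Proof.
move=> x y z; congr (_, _); last by rewrite /= mulgA.
by apply/ffunP => i; rewrite !ffunE /= permM GRing.addrA.
Qed.

Lemma affine_mul1 : left_id affine_one affine_mul.
Proof.
move=> [c p]; congr (_, _); last by rewrite /= mul1g.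
by apply/ffunP => i; rewrite !ffunE /= perm1 GRing.add0r.
Qed.

Lemma affine_mulr1 : right_id affine_one affine_mul.
Proof.
move=> [c p]; congr (_, _); last by rewrite /= mulg1.
by apply/ffunP => i; rewrite !ffunE /= GRing.addr0.
Qed.

Lemma affine_mulV : left_inverse affine_one affine_inv affine_mul.
Proof.
move=> [c p]; congr (_, _); last by rewrite /= mulVg.
by apply/ffunP => i; rewrite !ffunE /= GRing.addNr.
Qed.

Lemma affine_mulrV : right_inverse affine_one affine_inv affine_mul.
Proof.
move=> [c p]; congr (_, _); last by rewrite /= mulgV.
by apply/ffunP => i; rewrite !ffunE /= permK GRing.addrN.
Qed.

HB.instance Definition _ := isGroup.Build affine
  affine_mulA affine_mul1 affine_mulr1 affine_mulV affine_mulrV.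

Lemma affineM1 (x y : affine) i : (x * y).1 i = (x.1 i + y.1 (x.2 i))%R.
Proof. by rewrite ffunE. Qed.

Lemma affineM2 (x y : affine) : (x * y).2 = x.2 * y.2.
Proof. by []. Qed.

Lemma affine2_morph : {morph (fun x : affine => x.2) : x y / x * y}.
Proof. by []. Qed.

Lemma affine_eq (x y : affine) : x.1 =1 y.1 -> x.2 = y.2 -> x = y.
Proof. by case: x y => [c p] [d q] /= /ffunP-> ->. Qed.

Variables (a b z : A).

Definition crossing (g : VBgen n) : affine :=
  match g with
  | inl k => ([ffun i => if i == strand_lo k then a
                         else if i == strand_hi k then b else z], tau k)
  | inr k => ([ffun=> 0%R], tau k)
  end.

Lemma crossing2 g : (crossing g).2 = genP g.
Proof. by case: g. Qed.

(** Weights and end points on natural numbers, so that comparisons of positions are within reach of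
    [lia]. *)
Let weight (k i : nat) : A :=
  if i == k then a else if i == k.+1 then b else z.
Let pos (k i : nat) : nat := if i == k then k.+1 else if i == k.+1 then k else i.

Let weightE (k : 'I_n.-1) (i : 'I_n) : (crossing (inl k)).1 i = weight k i.
Proof. by rewrite ffunE -!val_eqE. Qed.

Let posE (k : 'I_n.-1) (i : 'I_n) : tau k i = pos k i :> nat.
Proof.
rewrite /tau /pos; case: tpermP => [->|->|].
- by rewrite eqxx.
- by rewrite /= eqxx; case: eqP => // /eqP; rewrite eqn_leq ltnn.
- by move=> /eqP + /eqP; rewrite -!val_eqE /= => /negPf-> /negPf->.
Qed.

Let wt (g : VBgen n) (i : nat) : A := if g is inl k then weight k i else 0%R.
Let endpt (g : VBgen n) (i : nat) : nat :=
  match g with inl k => pos k i | inr k => pos k i end.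

Let Fixpoint wtw (s : seq (VBgen n)) (i : nat) : A :=
  if s is g :: s' then (wt g i + wtw s' (endpt g i))%R else 0%R.

Let wtwE s (i : 'I_n) : (word_eval crossing (pos_word s)).1 i = wtw s i.
Proof.
elim: s i => [|g s IHs] i; first by rewrite /word_eval big_nil ffunE.
rewrite /word_eval big_cons affineM1 -/(word_eval _ _) IHs /=.
by case: g => k; rewrite /= ?weightE ?posE // ffunE.
Qed.

Local Ltac split_positions :=
  repeat match goal with
  | |- context [@eq_op _ ?x ?y] =>
    lazymatch x with
    | context [if _ then _ else _] => fail
    | _ => case: (@eqP _ x y) => ?
    end
  end.

(** Along each strand, the two sides of a relation collect the same weights up to order and zeros,
    which a case analysis on the position of the strand shows. *)
Lemma crossing_UVB u w : UVB_rel u w -> word_eval crossing u = word_eval crossing w.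
Proof.
move=> uw; apply: affine_eq; last first.
  have e t : (word_eval crossing t).2 = word_eval (@genP n) t.
    rewrite -[LHS]/(hom_of affine2_morph _) gmulf_word_eval.
    by apply: eq_word_eval => g; rewrite /= crossing2.
  by rewrite !e; apply: genP_UVB.
move=> i; case: uw => {u w} [_ _ [_ _ [j k ejk|j k ejk|j k ejk|j k ejk|j|j k ejk|j k ejk]|j k ejk]|j k ejk].
5: rewrite -[[::] in RHS]/(pos_word [::]).
all: rewrite !wtwE /= /weight /pos ?ejk.
all: try (move: ejk; rewrite /far => ejk).
all: split_positions; try (exfalso; lia).
all: rewrite ?GRing.add0r ?GRing.addr0 //; try exact: GRing.addrC.
all: by rewrite [RHS]GRing.addrC -GRing.addrA // [RHS]GRing.addrCA.
Qed.

End Affine.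

(* When f has kernel K, this says that [G, G] acts trivially on K / [K, K],
   without mentioning [K, K]. It only depends on K. *)
Definition commutator_central (G H0 : groupType) (f : {multiplicative G -> H0}) :=
  forall (H : groupType) (h : {multiplicative G -> H}),
    (forall x y, f x = 1 -> f y = 1 -> commute (h x) (h y)) ->
    forall x a b, f x = 1 -> commute (h x) (h [~ a, b]).

Lemma commutator_central_aut (G H0 : groupType) (f : {multiplicative G -> H0})
  (phi psi : {multiplicative G -> G}) :
  cancel phi psi -> cancel psi phi ->
  commutator_central f -> commutator_central (f \o phi).
Proof.
move=> phiK psiK fC H h hC x a b fx.
have := fC H (h \o psi) _ (phi x) (phi a) (phi b) fx.
rewrite /= !homR !phiK; apply=> u w fu fw /=.
by apply: hC; rewrite /= psiK.
Qed.

Lemma commutator_central_eq (G H0 H1 : groupType)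
  (f : {multiplicative G -> H0}) (k : {multiplicative G -> H1}) :
  (forall x, f x = 1 <-> k x = 1) ->
  commutator_central f -> commutator_central k.
Proof.
move=> fk fC H h hC x a b /fk fx; apply: fC => // u w /fk ku /fk kw.
exact: hC.
Qed.

(** As f factors through p, it induces a map from the finite group [K] onto itself, which is then
    injective. *)
Lemma kernel_eq (G : groupType) (K : finGroupType)
  (p f : {multiplicative G -> K}) :
  (forall g, exists x, p x = g) -> (forall g, exists x, f x = g) ->
  (forall x, p x = 1 -> f x = 1) -> forall x, f x = 1 -> p x = 1.
Proof.
move=> pS fS pf x fx.
have /choice[s sE] := pS; have /choice[t tE] := fS.
have fp y z : p y = p z -> f y = f z.
  move=> e; apply: (mulgI (f z^-1)); rewrite -!gmulfM mulVg hom1.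
  by apply: pf; rewrite gmulfM homV e mulVg.
have sf : cancel (fun g => p (t g)) (fun g => f (s g)).
  by move=> g; rewrite (fp _ (t g)) ?tE // sE.
have /bij_inj inj : bijective (fun g => f (s g)).
  have [r sr rs] := injF_bij (can_inj sf).
  by exists (fun g => p (t g)) => // g; rewrite -{1}(rs g) sf rs.
by apply: inj; rewrite (fp _ x) ?sE // fx (fp _ 1) ?sE ?hom1.
Qed.

(** * Groups lying between VB_n and UVB_n *)

Section Presentation.
Variables (n : nat) (R : word (VBgen n) -> word (VBgen n) -> Prop).
Hypothesis VB_R : forall u w, VB_rel u w -> R u w.
Hypothesis R_UVB : forall u w, R u w -> UVB_rel u w.

Notation G := (presented R : groupType).
Let s (i : 'I_n.-1) : G := pres_gen R (sigma i).
Let v (i : 'I_n.-1) : G := pres_gen R (virt i).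

Lemma genP_R u w : R u w -> word_eval (@genP n) u = word_eval (@genP n) w.
Proof. by move/R_UVB/genP_UVB. Qed.

Definition projP : {multiplicative G -> 'S_n} := hom_of (pres_liftM genP_R).

Lemma projP_s i : projP (s i) = tau i.
Proof. exact: (pres_lift_gen genP_R). Qed.

Lemma projP_v i : projP (v i) = tau i.
Proof. exact: (pres_lift_gen genP_R). Qed.

Lemma hom_vb_rels (H : groupType) (h : {multiplicative G -> H}) :
  vb_rels (h \o s) (h \o v).
Proof. by apply/(vb_relsP (h \o pres_gen R)) => u w /VB_R; apply: pres_hom_rel. Qed.

Let sv : vb_rels s v := hom_vb_rels idfun.

Lemma gen_ind (P : G -> Prop) :
  P 1 ->
  (forall x i, P x -> P (x * s i)) -> (forall x i, P x -> P (x * (s i)^-1)) ->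
  (forall x i, P x -> P (x * v i)) -> forall x, P x.
Proof.
move=> P1 Ps PsV Pv; apply: pres_ind => // x [] i; [exact: Ps|exact: Pv|exact: PsV|].
suff -> : (v i)^-1 = v i by apply: Pv.
by apply: (mulgI (v i)); rewrite mulgV (vb_vinvol sv).
Qed.

Section Virtual.
Variable p : {multiplicative G -> 'S_n}.
Hypothesis pv : forall i, p (v i) = tau i.

Lemma virt_inj (t u : seq 'I_n.-1) :
  p (vprod v t) = p (vprod v u) -> vprod v t = vprod v u.
Proof.
apply: vprod_inj pv _ _ => [i|i j|i j].
- exact: (vb_vinvol sv).
- exact: (vb_vbraid sv).
- exact: (vb_vcomm sv).
Qed.

Lemma virt_surj g : exists t, p (vprod v t) = g.
Proof. exact: vprod_surj pv g. Qed.

End Virtual.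

Lemma vprod_rcons t i : vprod v (rcons t i) = vprod v t * v i.
Proof. by rewrite -cats1 vprod_cat vprod_seq1. Qed.

Lemma projP_surj g : exists x, projP x = g.
Proof. by have [t] := virt_surj projP_v g; exists (vprod v t). Qed.

Lemma homv2 (H : groupType) (f : {multiplicative G -> H}) i : (f (v i))^-1 = f (v i).
Proof.
by rewrite -homV; congr (f _); apply: (mulgI (v i)); rewrite mulgV (vb_vinvol sv).
Qed.

(** Deleting the letters s_i or replacing them by v_i turns x into a word in the v_i with the same
    images under both p and f. If p x = 1, this word is trivial by [virt_inj]. *)
Lemma sub_kernel (p f : {multiplicative G -> 'S_n}) :
  (forall i, p (v i) = tau i) ->
  (forall i, (p (s i) = 1 /\ f (s i) = 1) \/
             (p (s i) = p (v i) /\ f (s i) = f (v i))) ->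
  forall x, p x = 1 -> f x = 1.
Proof.
move=> pv psv.
have main x : exists2 t, p x = p (vprod v t) & f x = f (vprod v t).
  apply: (gen_ind (P := fun x =>
    exists2 t, p x = p (vprod v t) & f x = f (vprod v t))) x
    => [|x i [t e fe]|x i [t e fe]|x i [t e fe]].
  - by exists [::]; rewrite vprod_nil !hom1.
  - case: (psv i) => -[pi fi].
      by exists t; rewrite gmulfM ?pi ?fi mulg1.
    by exists (rcons t i); rewrite vprod_rcons !gmulfM ?pi ?fi ?e ?fe.
  - case: (psv i) => -[pi fi].
      by exists t; rewrite gmulfM homV ?pi ?fi invg1 mulg1.
    exists (rcons t i); rewrite vprod_rcons !gmulfM homV ?pi ?fi ?e ?fe.
      by rewrite homv2.
    by rewrite homv2.
  - by exists (rcons t i); rewrite vprod_rcons !gmulfM ?e ?fe.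
move=> x px; have [t pt ->] := main x.
by rewrite (virt_inj pv (t := t) (u := [::])) -?pt ?vprod_nil ?hom1.
Qed.

Section Killed.
Variable p : {multiplicative G -> 'S_n}.
Hypotheses (n_gt1 : 1 < n) (pv : forall i, p (v i) = tau i) (ps : forall i, p (s i) = 1).

(* The images of all conjugates of the s i form the pair {S, S'}, and G permutes
   that pair through an abelian group. *)
Lemma commutator_central_killed : commutator_central p.
Proof.
move=> H h hC z a b pz; have hr := hom_vb_rels h.
have n1 : 0 < n.-1 by rewrite -ltnS prednK // ltnW.
pose i0 := Ordinal n1; pose S := h (s i0); pose V i := h (v i).
have V2 i : V i * V i = 1 by apply: (vb_vinvol hr).
have next (P : 'I_n.-1 -> Prop) : P i0 ->
    (forall i j : 'I_n.-1, j = i.+1 :> nat -> P i -> P j) -> forall i, P i.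
  move=> P0 PS [k kn]; elim: k kn => [|k IHk] kn.
    by have -> : Ordinal kn = i0 by apply: val_inj.
  exact: (PS (Ordinal (ltnW kn))).
(* Elements of the kernel have commuting images, so the braid relation collapses to an equality of
   two consecutive images. *)
have hs i : h (s i) = S.
  apply: (next (fun i => h (s i) = S)) => // {}i j eij <-.
  have c : commute (h (s i)) (h (s j)) by apply: hC; apply: ps.
  by have := vb_braid hr eij; rewrite /= -c -!mulgA => /mulgI/mulgI.
pose S' := S ^ V i0.
(* The mixed relation says that S commutes with V_i V_j; since V_j is an involution, V_i and V_j
   conjugate S to the same element. *)
have VS i : S ^ V i = S'.
  apply: (next (fun i => S ^ V i = S')) => // {}i j eij <-.
  have := vb_mixed hr eij; rewrite /= !hs -/(V i) -/(V j) => e.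
  have Vinv k : (V k)^-1 = V k by apply: homv2.
  rewrite !conjgE !Vinv; apply: (mulgI (V i)); rewrite 2!mulgA e.
  by rewrite -!mulgA V2 mulg1 !mulgA V2 mul1g.
have VS' i : S' ^ V i = S by rewrite -(VS i) -conjgM V2 conjg1.
have homJ x y : h (x ^ y) = h x ^ h y by rewrite !conjgE !gmulfM homV.
have cSS' : commute S' S.
  rewrite /S' /S /V -homJ; apply: hC; last exact: ps.
  by rewrite conjgE !gmulfM ps mul1g homV mulVg.
have SS' : S' ^ S = S' by apply/conjg_fixP/commgP.
have pair x : S ^ h x = S /\ S' ^ h x = S' \/ S ^ h x = S' /\ S' ^ h x = S.
  apply: (gen_ind (P := fun x =>
    S ^ h x = S /\ S' ^ h x = S' \/ S ^ h x = S' /\ S' ^ h x = S)) x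
    => [|x i IH|x i IH|x i IH]; first by rewrite hom1 !conjg1; left.
  - have S1 : S ^ S = S by rewrite conjgE mulKg.
    by rewrite gmulfM hs !conjgM; case: IH => -[-> ->]; rewrite S1 SS'; [left|right].
  - have S1 : S ^ S^-1 = S by apply: (canLR (conjgK _)); rewrite conjgE mulKg.
    have S1' : S' ^ S^-1 = S' by apply: (canLR (conjgK _)); rewrite SS'.
    by rewrite gmulfM homV hs !conjgM; case: IH => -[-> ->]; rewrite S1 S1'; [left|right].
  - by rewrite gmulfM !conjgM; case: IH => -[-> ->]; rewrite VS VS'; [right|left].
have fixS c d : commute S (h [~ c, d]).
  apply/commgP/conjg_fixP.
  have -> : [~ c, d] = (d * c)^-1 * (c * d) by rewrite commgEl conjgE invMg !mulgA.
  (* Permutations of a pair commute, so c d and d c act in the same way on S and S'. *)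
  have swap X : X = S \/ X = S' -> X ^ h (c * d) = X ^ h (d * c).
    by case=> ->; rewrite !gmulfM !conjgM;
      case: (pair c) => -[? ?]; case: (pair d) => -[? ?]; congruence.
  rewrite gmulfM conjgM swap; first by rewrite -conjgM -gmulfM mulVg hom1 conjg1.
  by case: (pair (d * c)^-1) => -[-> _]; [left|right].
pose T y := forall c d, commute y (h [~ c, d]).
have T1 : T 1 by move=> c d; rewrite /commute mul1g mulg1.
have TM y u : T y -> T u -> T (y * u).
  by move=> Ty Tu c d; apply/commute_sym/commuteM; apply/commute_sym.
have TJ y g : T y -> T (y ^ h g).
  move=> Ty c d; have := Ty (c ^ g^-1) (d ^ g^-1).
  rewrite -conjRg homJ homV; have := conjgKV (h g) (h [~ c, d]).
  move: (h [~ c, d]) (_ ^ _^-1) => u w <- yw.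
  by rewrite /commute -!conjMg yw.
have TV y : T y -> T y^-1 by move=> Ty c d; apply/commute_sym/commuteV/commute_sym.
(* Removing the letters s_i from y changes h y by a product of conjugates of S and of its inverse,
   all of which satisfy [T]. For z in the kernel, the word that remains is trivial. *)
have main y : exists2 t, p y = p (vprod v t) & T (h y * (h (vprod v t))^-1).
  apply: (gen_ind (P := fun y =>
    exists2 t, p y = p (vprod v t) & T (h y * (h (vprod v t))^-1))) y
    => [|y i [t e Tt]|y i [t e Tt]|y i [t e Tt]].
  - by exists [::]; rewrite vprod_nil // !hom1 mulgV.
  - exists t; first by rewrite gmulfM ps mulg1.
    have -> : h (y * s i) * (h (vprod v t))^-1 =
        S ^ h y^-1 * (h y * (h (vprod v t))^-1).
      by rewrite gmulfM hs conjgE homV invgK !mulgA mulgKV.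
    by apply: TM => //; apply: TJ.
  - exists t; first by rewrite gmulfM homV ps invg1 mulg1.
    have -> : h (y * (s i)^-1) * (h (vprod v t))^-1 =
        S^-1 ^ h y^-1 * (h y * (h (vprod v t))^-1).
      by rewrite gmulfM homV hs conjgE homV invgK !mulgA mulgKV.
    by apply: TM => //; apply: TJ; apply: TV.
  - exists (rcons t i); first by rewrite vprod_rcons !gmulfM e.
    by rewrite vprod_rcons !gmulfM invMg mulgA mulgK.
have [t pt] := main z.
rewrite (virt_inj pv (t := t) (u := [::])) -?pt ?vprod_nil ?hom1 //.
by rewrite invg1 mulg1; apply.
Qed.

End Killed.

(** The strand weights lift [projP] to the semidirect product of Z^n and S_n, where its kernel lands
    in the abelian group Z^n. There s_0 v_0 becomes a basis vector, which the 3-cycle given by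
    [v_0, v_1] moves. *)
Lemma projP_not_commutator_central : 2 < n -> ~ commutator_central projP.
Proof.
move=> n3.
have hR u w : R u w ->
    word_eval (crossing 1%R 0%R 0%R : _ -> affine int n) u =
    word_eval (crossing 1%R 0%R 0%R) w by move/R_UVB/crossing_UVB.
pose h : {multiplicative G -> affine int n} := hom_of (pres_liftM hR).
have hgen g : h (pres_gen R g) = crossing 1%R 0%R 0%R g by apply: (pres_lift_gen hR).
have h2 x : (h x).2 = projP x.
  apply: (pres_hom_ext (h := hom_of (@affine2_morph int n) \o h)) => g.
  transitivity (genP g); first by rewrite -(crossing2 1%R 0%R (0%R : int)) -hgen.
  by symmetry; apply: (pres_lift_gen genP_R).
have n2 : 1 < n.-1 by rewrite -ltnS prednK // (ltn_trans _ n3).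
pose i0 := Ordinal (ltnW n2); pose i1 := Ordinal n2.
have lo1 : strand_hi i0 = strand_lo i1 by apply: val_inj.
have px : projP (s i0 * v i0) = 1 by rewrite gmulfM projP_s projP_v tau2.
have hx i : (h (s i0 * v i0)).1 i = (i == strand_lo i0)%:R%R.
  rewrite gmulfM affineM1 !hgen !ffunE GRing.addr0.
  by case: eqP => // _; case: ifP.
have mv : projP [~ v i0, v i1] (strand_lo i0) = strand_hi i0.
  rewrite homR commgEl conjgE !projP_v !tpermV !permM tpermL lo1 tpermL.
  by rewrite [tau i0 _]tpermD ?tpermR // -val_eqE.
move=> /(_ _ h) C; have {C} := C _ (s i0 * v i0) (v i0) (v i1) px.
have comm x y : projP x = 1 -> projP y = 1 -> commute (h x) (h y).
  move=> x1 y1; apply: affine_eq => [i|]; last by rewrite !affineM2 !h2 x1 y1.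
  by rewrite !affineM1 !h2 x1 y1 !perm1 GRing.addrC.
move=> /(_ comm) /(congr1 (fun x : affine int n => x.1 (strand_lo i0))).
rewrite !affineM1 !h2 px perm1 mv !hx eqxx GRing.addrC => /GRing.addrI.
by rewrite -val_eqE.
Qed.

End Presentation.

(** * Surjections onto S_n for n >= 5 *)

Section SymmetricGroup.
Variable n : nat.

(** If x moves i, it does not commute with the transposition (i k) for a point k different from i
    and x i. *)
Lemma perm_center_trivial (x : 'S_n) :
  2 < n -> (forall y, commute x y) -> x = 1.
Proof.
move=> n3 xC; apply/permP => i; rewrite perm1; apply/eqP/negP => /negP xi.
have [k ki kxi] : exists2 k, k != i & k != x i.
  have : 0 < #|~: [set i; x i]|.
    by rewrite cardsCs setCK card_ord cards2 eq_sym xi /= subn_gt0.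
  by case/card_gt0P => k; rewrite !inE negb_or => /andP[]; exists k.
have := xC (tperm i k); move/esym/commgP/conjg_fixP; rewrite tpermJ.
move/(congr1 (fun s : 'S_n => s i)); rewrite tpermL.
case: tpermP => [e|e e'|_ _ e]; first by rewrite -e eqxx in xi.
  by rewrite e' eqxx in kxi.
by rewrite -e eqxx in ki.
Qed.

(** By simplicity, K contains Alt_n or meets it trivially. In the second case the commutators [x, y]
    with x in K are even and lie in K, so they are trivial and K is central. *)
Lemma normal_sym_trivial (K : {group 'S_n}) :
  4 < n -> K <| [set: 'S_n] -> K :=: 1 \/ 'Alt_('I_n) \subset K.
Proof.
move=> n5 nK; have /simpleP[_ simA] : simple 'Alt_('I_n).
  by apply: simple_Alt5; rewrite card_ord.
have nKA : 'Alt_('I_n) :&: K <| 'Alt_('I_n).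
  by apply: normalGI nK; apply: subsetT.
case: (simA _ nKA) => [e|/setIidPl]; [left|by right].
apply/trivgP/subsetP => x Kx; rewrite inE; apply/eqP.
apply: perm_center_trivial => [|y]; first exact: leq_trans n5.
apply/commgP; rewrite -in_set1 -[[set 1]]e inE Alt_even commgEl.
rewrite odd_permM odd_permJ odd_permV addbb /=.
by have [_ nKn] := andP nK; rewrite groupM ?groupV // memJ_norm // (subsetP nKn) ?inE.
Qed.

Lemma commute_tau (r : 'S_n) (j : 'I_n.-1) : commute r (tau j) ->
  [/\ r (strand_lo j) = strand_lo j \/ r (strand_lo j) = strand_hi j &
      r (strand_hi j) = strand_lo j \/ r (strand_hi j) = strand_hi j].
Proof.
move=> /esym/commgP/conjg_fixP; rewrite tpermJ => e.
have ne : strand_lo j != strand_hi j by rewrite -val_eqE /= neq_ltn leqnn.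
have nr : r (strand_lo j) != r (strand_hi j) by rewrite (inj_eq perm_inj).
split.
- have := congr1 (fun s : 'S_n => s (r (strand_lo j))) e; rewrite /= tpermL /tau.
  by case: tpermP => [-> _|-> _|_ _ e']; [left|right|rewrite e' eqxx in nr].
- have := congr1 (fun s : 'S_n => s (r (strand_hi j))) e; rewrite /= tpermR /tau.
  by case: tpermP => [-> _|-> _|_ _ e']; [left|right|rewrite e' eqxx in nr].
Qed.

(** Here r preserves the pairs {j, j + 1} with j >= 2. For n >= 5 there are at least two of them,
    and they force r to fix every point from 2 on, leaving only 0 and 1 to permute. *)
Lemma far_centralizer (r : 'S_n) (i0 : 'I_n.-1) : 4 < n -> i0 = 0 :> nat ->
  (forall j, far i0 j -> commute r (tau j)) -> r = 1 \/ r = tau i0.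
Proof.
move=> n5 i00 rC.
have lo m : 1 < m -> m < n -> m.+1 < n -> forall k : 'I_n, k = m :> nat ->
    r k = m :> nat \/ r k = m.+1 :> nat.
  move=> m1 mn m1n k km; have jn : m < n.-1 by rewrite ltn_predRL.
  have [|] := @commute_tau r (Ordinal jn); first by apply: rC; rewrite /far i00 /= m1.
  have -> : strand_lo (Ordinal jn) = k by apply: val_inj.
  by case=> ->; rewrite /= ?km; [left|right].
have hi m : 1 < m -> m.+1 < n -> forall k : 'I_n, k = m.+1 :> nat ->
    r k = m :> nat \/ r k = m.+1 :> nat.
  move=> m1 m1n k km; have jn : m < n.-1 by rewrite ltn_predRL.
  have [|_] := @commute_tau r (Ordinal jn); first by apply: rC; rewrite /far i00 /= m1.
  have -> : strand_hi (Ordinal jn) = k by apply: val_inj.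
  by case=> ->; rewrite /= ?km; [left|right].
(* Such a point is the intersection of the preserved pairs {k - 1, k} and {k, k + 1}. The end points
   2 and n - 1 then follow from injectivity. *)
have inner (k : 'I_n) : 2 < k -> k.+1 < n -> r k = k.
  move=> k2 kn; apply: val_inj => /=.
  have [] := lo k ltac:(lia) (ltn_ord k) kn k erefl; first by [].
  by have [] := hi k.-1 ltac:(lia) ltac:(lia) k ltac:(lia); lia.
have inj (k l : 'I_n) : r k = r l :> nat -> k = l :> nat.
  by move=> /val_inj /perm_inj ->.
have outer (k : 'I_n) : 1 < k -> r k = k.
  move=> k1; have kn := ltn_ord k; apply: val_inj => /=.
  case: (ltnP 2 k) => k2; last first.
    pose k3 := Ordinal (ltac:(lia) : 3 < n).
    have e3 : r k3 = 3 :> nat by rewrite inner.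
    have [] := lo 2 isT ltac:(lia) ltac:(lia) k ltac:(lia); first lia.
    by rewrite -e3 => /inj /=; lia.
  case: (ltnP k.+1 n) => kn1; first by rewrite inner.
  pose k' := Ordinal (ltac:(lia) : k.-1 < n).
  have e' : r k' = k.-1 :> nat by rewrite inner //=; lia.
  have [] := hi k.-1 ltac:(lia) ltac:(lia) k ltac:(lia); last lia.
  by rewrite -e' => /inj /=; lia.
have small (k : 'I_n) : k < 2 -> r k < 2.
  move=> k2; rewrite ltnNge; apply/negP => rk2.
  have /perm_inj rk := outer _ rk2.
  by move: k2 rk2; rewrite rk; lia.
pose k0 := strand_lo i0; pose k1 := strand_hi i0.
have e0 : k0 = 0%N :> nat by rewrite /= i00.
have e1 : k1 = 1%N :> nat by rewrite /= i00.
have r0 := small k0; have r1 := small k1; have r01 := inj k0 k1.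
have cases01 (k : 'I_n) : [\/ k = k0, k = k1 | 1 < k].
  case: (ltnP 1 k) => k2; first by constructor 3.
  case: (posnP k) => k3; [constructor 1|constructor 2]; apply: val_inj => /=; lia.
case: (posnP (r k0)) => rk0; [left|right]; apply/permP => k; apply: val_inj.
  rewrite perm1; case: (cases01 k) => [->|->|/outer -> //] /=; lia.
rewrite /tau -/k0 -/k1; case: (cases01 k) => [->|->|k2]; rewrite ?tpermL ?tpermR /=.
- by lia.
- by lia.
by rewrite outer // tpermD // -val_eqE /=; lia.
Qed.

End SymmetricGroup.

Section Large.
Variables (n : nat) (R : word (VBgen n) -> word (VBgen n) -> Prop).
Hypothesis VB_R : forall u w, VB_rel u w -> R u w.
Hypothesis R_UVB : forall u w, R u w -> UVB_rel u w.

Notation G := (presented R : groupType).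
Notation s i := (pres_gen R (sigma i)).
Notation v i := (pres_gen R (virt i)).

Lemma tau_not_comm (i j : 'I_n.-1) : j = i.+1 :> nat -> ~ commute (tau i) (tau j).
Proof.
move=> eij /commute_tau[+ _].
have -> : strand_lo j = strand_hi i by apply: val_inj.
by rewrite tpermR => -[] /(congr1 val) /=; lia.
Qed.

Section Hom.
Variable f : {multiplicative G -> 'S_n}.
Hypothesis f_surj : forall g, exists x, f x = g.

Lemma surj_gen_not_comm : 2 < n ->
  ~ (forall a b : VBgen n, commute (f (pres_gen R a)) (f (pres_gen R b))).
Proof.
move=> n3 comm.
have comm1 a x : commute (f (pres_gen R a)) (f x).
  apply: (pres_ind (P := fun x : G => commute (f (pres_gen R a)) (f x))) x
    => [|x b fx|x b fx]; first by rewrite hom1 /commute mul1g mulg1.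
    by rewrite gmulfM; apply: commuteM.
  by rewrite gmulfM homV; apply: commuteM => //; apply: commuteV.
have comm2 y x : commute (f x) (f y).
  apply: (pres_ind (P := fun x : G => commute (f x) (f y))) x
    => [|x b fx|x b fx]; first by rewrite hom1 /commute mul1g mulg1.
    by rewrite gmulfM; apply/commute_sym/commuteM/commute_sym.
  rewrite gmulfM homV; apply/commute_sym/commuteM; first exact/commute_sym.
  by apply: commuteV; apply/commute_sym.
have n2 : 1 < n.-1 by lia.
have [x fx] := f_surj (tau (Ordinal (ltnW n2))); have [y fy] := f_surj (tau (Ordinal n2)).
by have := comm2 y x; rewrite fx fy; apply: tau_not_comm.
Qed.

Let fr : vb_rels (fun i => f (s i)) (fun i => f (v i)) := hom_vb_rels VB_R f.

(** The same element conjugates f (s i) to f (s j) and f (v i) to f (v j), so that both f (s i) = 1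
    and f (s i) = f (v i) propagate to the next index. *)
Let fs_conj (i j : 'I_n.-1) : j = i.+1 :> nat -> f (s j) = f (s i) ^ (f (v i) * f (v j))^-1.
Proof.
move=> eij; have := vb_mixed fr eij => /= e.
by rewrite conjgE invgK mulgA e -[_ * f (v i) * f (v j)]mulgA mulgK.
Qed.

Let fv_conj (i j : 'I_n.-1) : j = i.+1 :> nat -> f (v j) = f (v i) ^ (f (v i) * f (v j))^-1.
Proof.
move=> eij; have := vb_vbraid fr eij => /= e.
by rewrite conjgE invgK mulgA e -[_ * f (v i) * f (v j)]mulgA mulgK.
Qed.

Let next (P : 'I_n.-1 -> Prop) (i0 : 'I_n.-1) : i0 = 0 :> nat -> P i0 ->
  (forall i j : 'I_n.-1, j = i.+1 :> nat -> P i -> P j) -> forall i, P i.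
Proof.
move=> e0 P0 PS [k kn]; elim: k kn => [|k IHk] kn.
  by have -> : Ordinal kn = i0 by apply: val_inj.
exact: (PS (Ordinal (ltnW kn))).
Qed.

(** If all f (v i) agree, the conjugating elements of [fs_conj] are trivial and all f (s i) agree
    too. As s_0 commutes with v_2, the image would be abelian. *)
Lemma surj_fv_not_const : 3 < n -> ~ (forall i j, f (v i) = f (v j)).
Proof.
move=> n4 fvE; apply: surj_gen_not_comm; first exact: ltnW.
have n2 : 2 < n.-1 by lia.
pose i0 := Ordinal (ltnW (ltnW n2)); pose i2 := Ordinal n2.
have fsE i : f (s i) = f (s i0).
  apply: (next (P := fun i => f (s i) = f (s i0)) (i0 := i0)) => // {}i j eij <-.
  by rewrite (fs_conj eij) (fvE j i) (vb_vinvol fr) invg1 conjg1.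
have c : commute (f (s i0)) (f (v i0)).
  by rewrite (fvE i0 i2); apply: (vb_mcomm fr).
case=> i [] j; rewrite -/(sigma _) -/(virt _) ?fsE ?(fvE _ i0) //.
Qed.

(** Restricting f to the copy of S_n generated by the v_i gives an endomorphism [al] of S_n. Its
    kernel cannot contain Alt_n, since all f (v i) would agree; so [al] is bijective, and
    [far_centralizer] applies to the preimage of f (s_0). *)
Lemma surj_killed_or_equal : 4 < n ->
  (forall i, f (s i) = 1) \/ (forall i, f (s i) = f (v i)).
Proof.
move=> n5.
pose p := projP R_UVB; have pv i : p (v i) = tau i by apply: projP_v.
pose V := vprod (fun i => v i).
have /choice[w wE] g : exists t, p (V t) = g by apply: (virt_surj pv).
pose al g := f (V (w g)).
have alE t : al (p (V t)) = f (V t).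
  by congr (f _); apply: (virt_inj VB_R pv); rewrite wE.
have alM : {in [set: 'S_n] &, {morph al : g h / g * h}}.
  by move=> g h _ _; rewrite -{1}(wE g) -{1}(wE h) -gmulfM
    /V -vprod_cat -/(V _) alE /V vprod_cat gmulfM.
have altau i : al (tau i) = f (v i).
  by have := alE [:: i]; rewrite /V vprod_seq1 pv.
pose am := Morphism alM.
have [kal|kal] := normal_sym_trivial n5 (ker_normal am); last first.
  case: surj_fv_not_const => [|i j]; first exact: ltnW.
  have : tau i * tau j \in 'ker am.
    apply: (subsetP kal); rewrite Alt_even odd_permM !odd_tperm.
    by rewrite -!val_eqE /= !neq_ltn !leqnn.
  move/mker; rewrite /= alM ?inE // !altau => e.
  by apply: (mulIg (f (v j))); rewrite e (vb_vinvol fr).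
have al_inj : injective al.
  by move=> g h; apply: (injmP (f := am) _); rewrite ?kal ?inE //; apply/trivgP.
have [be _ beK] := injF_bij al_inj.
have n1 : 0 < n.-1 by lia.
pose i0 := Ordinal n1.
have [r rE] : exists r, al r = f (s i0) by exists (be (f (s i0))).
have rC j : far i0 j -> commute r (tau j).
  move=> i0j; apply: al_inj; rewrite !alM ?inE // rE altau.
  exact: (vb_mcomm fr).
have [r1|r1] := far_centralizer n5 (erefl : i0 = 0 :> nat) rC; [left|right].
  have al1 : al 1 = 1 by apply: (morph1 am).
  apply: (next (P := fun i => f (s i) = 1) (i0 := i0)) => // [|i j eij fi].
    by rewrite -rE r1.
  by rewrite (fs_conj eij) fi conj1g.
apply: (next (P := fun i => f (s i) = f (v i)) (i0 := i0)) => // [|i j eij fi].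
  by rewrite -rE r1 altau.
by rewrite (fs_conj eij) fi -fv_conj.
Qed.

End Hom.
End Large.

(** * Enumeration of the surjections for n = 3, 4 *)

(* Permutations are encoded by their lists of images, on which vm_compute runs. *)
Section Code.
Variable m : nat.
Implicit Types p q : 'S_m.

Definition code p : seq nat := [seq val (p i) | i <- enum 'I_m].

Lemma size_code p : size (code p) = m.
Proof. by rewrite size_map size_enum_ord. Qed.

Lemma nth_code p (i : 'I_m) : nth 0 (code p) i = p i.
Proof. by rewrite (nth_map i) ?size_enum_ord // nth_ord_enum. Qed.

Lemma code_inj : injective code.
Proof.
by move=> p q e; apply/permP => i; apply: val_inj; rewrite /= -!nth_code e.
Qed.

Lemma code1 : code 1 = iota 0 m.
Proof. by rewrite -val_enum_ord; apply: eq_map => i; rewrite perm1. Qed.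

Lemma code_perms p : code p \in permutations (iota 0 m).
Proof.
rewrite mem_permutations; apply: uniq_perm; rewrite ?iota_uniq //.
  by rewrite map_inj_uniq ?enum_uniq // => i j /val_inj/perm_inj.
move=> k; rewrite mem_iota /= add0n; apply/mapP/idP => [[i _ ->]|km]; first exact: ltn_ord.
by exists (p^-1 (Ordinal km)); rewrite ?mem_enum // permKV.
Qed.

Lemma code_onto l : l \in permutations (iota 0 m) -> exists p, code p = l.
Proof.
rewrite mem_permutations => ml.
have sl : size l = m by rewrite (perm_size ml) size_iota.
have ul : uniq l by rewrite (perm_uniq ml) iota_uniq.
have lt (i : 'I_m) : nth 0 l i < m.
  have : nth 0 l i \in iota 0 m by rewrite -(perm_mem ml) mem_nth // sl.
  by rewrite mem_iota.
have inj : injective (fun i => Ordinal (lt i)).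
  move=> i j /(congr1 val)/= /eqP; rewrite nth_uniq ?sl // => /eqP.
  exact: val_inj.
exists (perm inj); apply: (@eq_from_nth _ 0); first by rewrite size_code.
move=> i; rewrite size_code => im.
by rewrite -[i]/(val (Ordinal im)) nth_code permE.
Qed.

End Code.

Definition code_mul (a b : seq nat) : seq nat := [seq nth 0 b i | i <- a].
Local Notation "a ** b" := (code_mul a b) (at level 40, left associativity).

Definition code_inv (a : seq nat) : seq nat := [seq index i a | i <- iota 0 (size a)].

Lemma codeM m (p q : 'S_m) : code (p * q) = code_mul (code p) (code q).
Proof. by rewrite /code_mul -map_comp; apply: eq_map => i; rewrite /= nth_code permM. Qed.

Lemma codeV m (p : 'S_m) : code p^-1 = code_inv (code p).
Proof.
rewrite /code_inv size_code -val_enum_ord -map_comp; apply: eq_map => i /=.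
have e : (i : nat) = nth 0 (code p) (p^-1 i) by rewrite nth_code permKV.
rewrite [X in index X _]e index_uniq ?size_code //.
by have := code_perms p; rewrite mem_permutations => /perm_uniq->; rewrite iota_uniq.
Qed.

Definition code_prod (m : nat) (s : seq (seq nat)) : seq nat :=
  foldr code_mul (iota 0 m) s.

Section VBCheck.
Variables (k : nat) (s v : nat -> seq nat).

Definition vb_check : bool :=
  all (fun i => all (fun j =>
    [&& (j == i.+1) ==> [&& s i ** s j ** s i == s j ** s i ** s j,
          v i ** v j ** v i == v j ** v i ** v j &
          v i ** v j ** s i == s j ** v i ** v j],
        (i.+1 < j) || (j.+1 < i) ==> [&& s i ** s j == s j ** s i,
          v i ** v j == v j ** v i & s i ** v j == v j ** s i] &
        v i ** v i == iota 0 (size (v i))])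
    (iota 0 k)) (iota 0 k).

Definition forbidden_check : bool :=
  all (fun i => all (fun j =>
    (j == i.+1) ==> (v i ** s j ** s i == s j ** s i ** v j)) (iota 0 k)) (iota 0 k).

End VBCheck.

Lemma vb_checkP n m (s v : 'I_n.-1 -> 'S_m) (cs cv : nat -> seq nat) :
  (forall i, code (s i) = cs i) -> (forall i, code (v i) = cv i) ->
  vb_check n.-1 cs cv <-> vb_rels s v.
Proof.
move=> sE vE.
have mem (i : 'I_n.-1) : (i : nat) \in iota 0 n.-1 by rewrite mem_iota /= add0n ltn_ord.
have eqc (p q : 'S_m) : (code p == code q) = (p == q) by rewrite (inj_eq (@code_inj m)).
split=> [/allP chk|rel].
  have {}chk (i j : 'I_n.-1) := allP (chk i (mem i)) j (mem j).
  have adj (i j : 'I_n.-1) : j = i.+1 :> nat -> [/\ s i * s j * s i = s j * s i * s j,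
      v i * v j * v i = v j * v i * v j & v i * v j * s i = s j * v i * v j].
    move=> e; have /and3P[/implyP + _ _] := chk i j; rewrite e eqxx -e => /(_ isT).
    by rewrite -!sE -!vE -!codeM !eqc => /and3P[/eqP ? /eqP ? /eqP ?].
  have fr (i j : 'I_n.-1) : far i j -> [/\ s i * s j = s j * s i,
      v i * v j = v j * v i & s i * v j = v j * s i].
    rewrite /far => e; have /and3P[_ /implyP/(_ e) + _] := chk i j.
    by rewrite -!sE -!vE -!codeM !eqc => /and3P[/eqP ? /eqP ? /eqP ?].
  split=> [i j /adj[]//|i j /fr[]//|i j /adj[]//|i j /fr[]//|i|i j /fr[]//|i j /adj[]//].
  by have /and3P[_ _] := chk i i; rewrite -vE size_code -code1 -codeM eqc => /eqP.
apply/allP => i; rewrite mem_iota /= add0n => ik.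
apply/allP => j; rewrite mem_iota /= add0n => jk.
rewrite -[i]/(val (Ordinal ik)) -[j]/(val (Ordinal jk)) -!sE -!vE.
rewrite size_code -code1 -!codeM !eqc (vb_vinvol rel) eqxx andbT.
apply/andP; split; apply/implyP => e.
  move/eqP: e => e.
  by rewrite (vb_braid rel e) (vb_vbraid rel e) (vb_mixed rel e) !eqxx.
by rewrite (vb_comm rel e) (vb_vcomm rel e) (vb_mcomm rel e) !eqxx.
Qed.

Section FinitePairs.
Variables (X : choiceType) (R : word X -> word X -> Prop).
Variables (K L : finGroupType).
Variables (f : {multiplicative presented R -> K}) (h : {multiplicative presented R -> L}).

(* A multiplicatively closed subset of a finite group is a subgroup. *)
Lemma pres_ind_fin (P : K -> L -> Prop) :
  P 1 1 -> (forall a b c d, P a b -> P c d -> P (a * c) (b * d)) ->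
  (forall g, P (f (pres_gen R g)) (h (pres_gen R g))) -> forall x, P (f x) (h x).
Proof.
move=> P1 PM Pg x.
apply: (pres_ind (P := fun x : presented R => P (f x) (h x))) x
  => [|y g Py|y g Py]; first by rewrite !hom1.
  by rewrite !gmulfM; apply: PM.
rewrite !gmulfM !homV; apply: (PM) => //.
move: (f _) (h _) (Pg g) => a b Pab; pose N := (#[a] * #[b])%N.
have PX i : P (a ^+ i) (b ^+ i).
  by elim: i => [|i IHi]; rewrite ?expg0 // !expgS; apply: (PM).
have inv (M : finGroupType) (z : M) : z ^+ N = 1 -> z ^+ N.-1 = z^-1.
  move=> zN; apply: (mulgI z); rewrite -expgS prednK ?zN ?mulgV //.
  by rewrite muln_gt0 !order_gt0.
have := PX N.-1; rewrite !inv //.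
  by rewrite /N mulnC expgM expg_order expg1n.
by rewrite /N expgM expg_order expg1n.
Qed.

End FinitePairs.

(* The action of S_4 on the three pairings of {0, 1, 2, 3}; the pairing number j
   contains the pair {0, j + 1}. The kernel is the Klein four-group. *)
Definition on_pairings (a : seq nat) : seq nat :=
  [seq (if nth 0 a 0 == 0 then nth 0 a j
        else if nth 0 a j == 0 then nth 0 a 0
        else 6 - nth 0 a 0 - nth 0 a j)%N.-1 | j <- iota 1 3].

Definition codes (m : nat) : seq (seq nat) := permutations (iota 0 m).

(** A homomorphism S_m -> S_3 on codes; the instances are the identity for m = 3 and [on_pairings]
    for m = 4. *)
Definition code_morph (m : nat) (r : seq nat -> seq nat) : bool :=
  (r (iota 0 m) == iota 0 3) &&
  all (fun a => all (fun b =>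
    r (code_mul a b) == code_mul (r a) (r b)) (codes m)) (codes m).

Lemma code_morphM m r : code_morph m r -> forall p q : 'S_m,
  r (code (p * q)) = code_mul (r (code p)) (r (code q)).
Proof.
case/andP=> _ /allP rM p q.
by rewrite codeM; apply/eqP/(allP (rM _ (code_perms p)))/code_perms.
Qed.

Lemma on_pairings_morph : code_morph 4 on_pairings.
Proof. by vm_compute. Qed.

Lemma on_pairings_kernel (p q : 'S_4) :
  on_pairings (code p) = iota 0 3 -> on_pairings (code q) = iota 0 3 -> commute p q.
Proof.
move=> kp kq.
have : all (fun a => all (fun b => (on_pairings a == iota 0 3) ==>
    (on_pairings b == iota 0 3) ==> (code_mul a b == code_mul b a)) (codes 4)) (codes 4).
  by vm_compute.
move=> /allP/(_ _ (code_perms p))/allP/(_ _ (code_perms q)).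
by rewrite kp kq eqxx /= -!codeM => /eqP/code_inj.
Qed.

(** In these letters the boolean marks virtual generators and not inverses: all words from here on
    are positive. *)
Definition letter_code (s v : nat -> seq nat) (l : bool * nat) : seq nat :=
  if l.1 then v l.2 else s l.2.

Section Letters.
Variable k : nat.
Notation n := k.+2.
Variable R : word (VBgen n) -> word (VBgen n) -> Prop.

Definition letter_gen (l : bool * nat) : VBgen n :=
  if l.1 then @virt n (inord l.2) else @sigma n (inord l.2).

Definition word_prod (w : seq (bool * nat)) : presented R :=
  \prod_(l <- w) pres_gen R (letter_gen l).

Lemma code_word_prod m (h : {multiplicative presented R -> 'S_m}) (cs cv : nat -> seq nat) w :
  (forall i : 'I_k.+1, code (h (pres_gen _ (@sigma n i))) = cs i) ->
  (forall i : 'I_k.+1, code (h (pres_gen _ (@virt n i))) = cv i) ->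
  all (fun l => l.2 <= k) w ->
  code (h (word_prod w)) = code_prod m [seq letter_code cs cv l | l <- w].
Proof.
move=> csE cvE; elim: w => [_|[b i] w IHw /= /andP[ik wk]].
  by rewrite /word_prod big_nil hom1 code1.
rewrite /word_prod big_cons gmulfM codeM -/(word_prod w) IHw //; congr code_mul.
by rewrite /letter_gen /letter_code; case: b; rewrite /= ?csE ?cvE inordK.
Qed.

End Letters.

(** * Lifts of surjections through the Klein four-group *)

Section Lift.
Variable k : nat.
Notation n := k.+2.

Definition noncommuting (cs cv : nat -> seq nat) (w : seq (bool * nat))
    (l : (bool * nat) * (bool * nat)) : bool :=
  let x := code_prod 4 [seq letter_code cs cv l | l <- w] in
  let a := letter_code cs cv l.1 in let b := letter_code cs cv l.2 in
  let c := code_mul (code_inv a) (code_mul (code_inv b) (code_mul a b)) in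
  [&& l.1.2 <= k, l.2.2 <= k & code_mul x c != code_mul c x].

Definition probes : seq ((bool * nat) * (bool * nat)) :=
  [:: ((true, 0), (true, 1%N)); ((true, 0), (false, 0)); ((true, 1%N), (false, 0))].

Definition lift_check (r : seq nat -> seq nat) (fs fv cs cv : nat -> seq nat)
    (words : seq (seq (bool * nat))) : bool :=
  [&& all (fun i => [&& cs i \in codes 4, cv i \in codes 4,
        on_pairings (cs i) == r (fs i) & on_pairings (cv i) == r (fv i)]) (iota 0 k.+1),
      vb_check k.+1 cs cv &
      has (fun w => [&& all (fun l => l.2 <= k) w,
        code_prod n [seq letter_code fs fv l | l <- w] == iota 0 n &
        has (noncommuting cs cv w) probes]) words].

(** The tables [cs] and [cv] define h : VB_n -> S_4 lifting r o f along [on_pairings], so h maps the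
    kernel of f into the abelian Klein four-group. A word of that kernel whose image fails to
    commute with the image of a commutator refutes centrality. *)
Lemma lift_not_commutator_central (f : {multiplicative VB n -> 'S_n}) r
    (fs fv cs cv : nat -> seq nat) words :
  code_morph n r ->
  (forall i : 'I_k.+1, code (f (pres_gen _ (@sigma n i))) = fs i) ->
  (forall i : 'I_k.+1, code (f (pres_gen _ (@virt n i))) = fv i) ->
  lift_check r fs fv cs cv words -> ~ commutator_central f.
Proof.
move=> rM fsE fvE /and3P[/allP fib vb /hasP[w _ /and3P[wk wf]]].
case/hasP=> [[l l']] _ /and3P[/= lk l'k ne].
have {}fib (i : 'I_k.+1) : [/\ cs i \in codes 4, cv i \in codes 4,
    on_pairings (cs i) = r (fs i) & on_pairings (cv i) = r (fv i)].
  by case/and4P: (fib i ltac:(rewrite mem_iota /= add0n; exact: ltn_ord)) =>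
    ? ? /eqP ? /eqP ?.
pose c (g : VBgen n) := match g with inl i => cs (i : 'I_k.+1) | inr i => cv (i : 'I_k.+1) end.
have /choice[q qE] (g : VBgen n) : exists p : 'S_4, code p = c g.
  by apply: code_onto; case: g => i; case: (fib i).
have qR : vb_rels (q \o @sigma n) (q \o @virt n).
  by apply/(vb_checkP (n := n) (cs := cs) (cv := cv)) => // i; rewrite /= qE.
move/vb_relsP in qR.
pose h : {multiplicative VB n -> 'S_4} := hom_of (pres_liftM qR).
have hE g : h (pres_gen _ g) = q g by apply: (pres_lift_gen qR).
have hs (i : 'I_k.+1) : code (h (pres_gen _ (@sigma n i))) = cs i by rewrite hE qE.
have hv (i : 'I_k.+1) : code (h (pres_gen _ (@virt n i))) = cv i by rewrite hE qE.
have hf x : on_pairings (code (h x)) = r (code (f x)).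
  apply: (pres_ind_fin (f := f) (h := h)
    (P := fun a b => on_pairings (code b) = r (code a))) => [|a b a' b' e e'|[] i].
  - by rewrite !code1; case/andP: rM => /eqP->.
  - by rewrite (code_morphM rM) (code_morphM on_pairings_morph) e e'.
  - by rewrite hs fsE; case: (fib i).
  - by rewrite hv fvE; case: (fib i).
have kh x : f x = 1 -> on_pairings (code (h x)) = iota 0 3.
  by move=> fx; rewrite hf fx code1; case/andP: rM => /eqP->.
have comm x y : f x = 1 -> f y = 1 -> commute (h x) (h y).
  by move=> /kh kx /kh ky; apply: on_pairings_kernel.
have fw : f (word_prod (@VB_rel n) w) = 1.
  by apply: (@code_inj n); rewrite (code_word_prod fsE fvE) // (eqP wf) code1.
have hl l0 : l0.2 <= k -> code (h (pres_gen _ (letter_gen k l0))) = letter_code cs cv l0.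
  by case: l0 => [[] i] ik; rewrite /letter_gen /letter_code /= ?hs ?hv inordK.
move=> /(_ _ h comm _ (pres_gen _ (letter_gen k l)) (pres_gen _ (letter_gen k l')) fw) e.
move/eqP: ne; apply; rewrite -(code_word_prod hs hv) // -!hl //.
have := congr1 (@code 4) e.
by rewrite homR commgEl conjgE !codeM !codeV.
Qed.

End Lift.

(** Hence s_0 and the v_i determine every s_i, which shortens the enumerations. *)
Lemma vb_next n (G : groupType) (s v : 'I_n.-1 -> G) (i j : 'I_n.-1) :
  vb_rels s v -> j = i.+1 :> nat -> s j = v i * v j * s i * v j * v i.
Proof.
move=> sv eij; rewrite (vb_mixed sv eij) -!mulgA.
by rewrite [v j * (v j * _)]mulgA (vb_vinvol sv) mul1g (vb_vinvol sv) mulg1.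
Qed.

(** Parity of the number of inversions. *)
Definition code_even (a : seq nat) : bool :=
  ~~ odd (sumn [seq count (fun y => y < nth 0 a i) (drop i a) | i <- iota 0 (size a)]).

(* For n = 3, 4, these include every maximal subgroup of S_n. *)
Definition small_subgroups (n : nat) : seq (pred (seq nat)) :=
  code_even
  :: [seq (fun a => nth 0 a i == i) | i <- iota 0 n]
  ++ (if n == 4 then [seq (fun a => nth 0 (on_pairings a) j == j) | j <- iota 0 3] else [::]).

Definition subgroup_check (n : nat) (Q : pred (seq nat)) : bool :=
  [&& Q (iota 0 n), has (predC Q) (codes n) &
      all (fun a => all (fun b => Q a ==> Q b ==> Q (code_mul a b)) (codes n)) (codes n)].

Lemma small_subgroupsP n : n = 3 \/ n = 4 -> all (subgroup_check n) (small_subgroups n).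
Proof. by case=> ->; vm_compute. Qed.

(** A necessary condition for surjectivity: no listed proper subgroup contains all the images of the
    generators. *)
Definition surj_check (k : nat) (fs fv : nat -> seq nat) : bool :=
  all (fun Q => has (fun i => ~~ Q (fs i) || ~~ Q (fv i)) (iota 0 k.+1))
    (small_subgroups k.+2).

Section Small.
Variable k : nat.
Notation n := k.+2.
Hypothesis n34 : n = 3 \/ n = 4.
Variable R : word (VBgen n) -> word (VBgen n) -> Prop.
Variable f : {multiplicative presented R -> 'S_n}.
Hypothesis f_surj : forall g, exists x, f x = g.

Lemma surj_checkP (fs fv : nat -> seq nat) :
  (forall i : 'I_k.+1, code (f (pres_gen _ (@sigma n i))) = fs i) ->
  (forall i : 'I_k.+1, code (f (pres_gen _ (@virt n i))) = fv i) ->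
  surj_check k fs fv.
Proof.
move=> fsE fvE; apply/allP => Q /(allP (small_subgroupsP n34)) /and3P[Q1 /hasP[l lP nQl] QM].
case: hasP => // nQ; case/negP: nQl.
have {}nQ (i : 'I_k.+1) : Q (fs i) /\ Q (fv i).
  apply/andP; rewrite -[_ && _]negbK negb_and; apply/negP => h; case: nQ.
  by exists (i : nat); rewrite // mem_iota /= add0n; apply: ltn_ord.
have [p <-] := code_onto lP; have [x <-] := f_surj p.
apply: (pres_ind_fin (f := f) (h := f) (P := fun a _ => Q (code a))) => [|a b c d Qa Qc|[] i].
- by rewrite code1.
- rewrite codeM; have /allP/(_ _ (code_perms a))/allP/(_ _ (code_perms c)) := QM.
  by rewrite Qa Qc.
- by rewrite fsE; case: (nQ i).
- by rewrite fvE; case: (nQ i).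
Qed.

End Small.

Definition fiber (r : seq nat -> seq nat) (a : seq nat) : seq (seq nat) :=
  [seq l <- codes 4 | on_pairings l == r a].

Definition s3_table (a b t : seq nat) : nat -> seq nat := nth [::] [:: t; a ** b ** t ** b ** a].
Definition v3_table (a b : seq nat) : nat -> seq nat := nth [::] [:: a; b].

Definition s4_table (a b d t : seq nat) : nat -> seq nat :=
  let u := a ** b ** t ** b ** a in nth [::] [:: t; u; b ** d ** u ** d ** b].
Definition v4_table (a b d : seq nat) : nat -> seq nat := nth [::] [:: a; b; d].

Local Notation V i := (true, i%N).
Local Notation S i := (false, i%N).

(* Found by search: for each surjection onto S_3 (S_4 for words4) that does not
   kill the sigma_i, one of these words lies in its kernel and some lift maps it
   to a nontrivial element of the Klein four-group. *)
Definition words3 : seq (seq (bool * nat)) :=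
  [:: [:: S 0; S 0]; [:: V 0; S 0; V 0; S 0]; [:: V 0; S 0]; [:: V 1; S 0];
      [:: V 0; S 0; V 1]; [:: V 0; V 1; S 0]; [:: V 0; S 1]].

Definition words4 : seq (seq (bool * nat)) :=
  [:: [:: V 0; V 2]; [:: V 0; S 0]; [:: V 0; S 2]].

(** Conditionals instead of implications keep [vm_compute] from running the search for a lift when
    an earlier condition fails. *)
Definition lift3_check (a b t : seq nat) : bool :=
  let fs := s3_table a b t in let fv := v3_table a b in
  if vb_check 2 fs fv then
    if surj_check 1 fs fv then
      if t == iota 0 3 then true else
      has (fun A => has (fun B => has (fun T =>
        lift_check 1 id fs fv (s3_table A B T) (v3_table A B) words3)
        (fiber id t)) (fiber id b)) (fiber id a)
    else true
  else true.

Lemma lift3_check_all :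
  all (fun a => all (fun b => all (lift3_check a b) (codes 3)) (codes 3)) (codes 3).
Proof. by vm_compute. Qed.

Definition lift4_check (a b d t : seq nat) : bool :=
  let fs := s4_table a b d t in let fv := v4_table a b d in
  if vb_check 3 fs fv then
    if surj_check 2 fs fv then
      if t == iota 0 4 then true else
      has (fun A => has (fun B => has (fun D => has (fun T =>
        lift_check 2 on_pairings fs fv (s4_table A B D T) (v4_table A B D) words4)
        (fiber on_pairings t)) (fiber on_pairings d))
        (fiber on_pairings b)) (fiber on_pairings a)
    else true
  else true.

(** The relations between the v_i prune the quadruples before t is enumerated. *)
Definition all4 (P : seq nat -> seq nat -> seq nat -> seq nat -> bool) : bool :=
  all (fun a => if a ** a == iota 0 4 then
    all (fun b => if a ** b ** a == b ** a ** b then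
      all (fun d => if (b ** d ** b == d ** b ** d) && (a ** d == d ** a) then
        all (fun t => P a b d t) (codes 4)
      else true) (codes 4)
    else true) (codes 4)
  else true) (codes 4).

Lemma lift4_check_all : all4 lift4_check.
Proof. by vm_compute. Qed.

(** * Cocycles *)

Import GRing.Theory.

Definition cocycle (G : groupType) n (f : G -> 'S_n) (c : G -> 'I_n -> rat) : Prop :=
  forall x y i, c (x * y) i = (c x i + c y (f x i))%R.

Section Cocycle.
Variables (n : nat) (R : word (VBgen n) -> word (VBgen n) -> Prop).
Hypothesis R_UVB : forall u w, R u w -> UVB_rel u w.
Hypothesis n_gt2 : 2 < n.

Notation G := (presented R : groupType).
Notation p := (projP R_UVB).

Lemma crossing_R (a b z : rat) u w : R u w ->
  word_eval (crossing a b z : _ -> affine rat n) u = word_eval (crossing a b z) w.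
Proof. by move/R_UVB/crossing_UVB. Qed.

Let w3 (a : 'I_3) (k : nat) : rat := ((a : nat) == k)%:R%R.

(** The weights (a, b, z) of [crossing] run over the standard basis of Q^3. *)
Definition strand_weight (a : 'I_3) : {multiplicative G -> affine rat n} :=
  hom_of (pres_liftM (crossing_R (w3 a 0) (w3 a 1%N) (w3 a 2))).

Lemma strand_weight_gen a g : strand_weight a (pres_gen R g) =
  crossing (w3 a 0) (w3 a 1%N) (w3 a 2) g.
Proof. exact: (pres_lift_gen (crossing_R _ _ _)). Qed.

Lemma strand_weight2 a x : (strand_weight a x).2 = p x.
Proof.
apply: (pres_hom_ext (h := hom_of (@affine2_morph rat n) \o strand_weight a)) => g.
transitivity (genP g).
  by rewrite -(crossing2 (w3 a 0) (w3 a 1%N) (w3 a 2)) -strand_weight_gen.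
by symmetry; apply: (pres_lift_gen (genP_R R_UVB)).
Qed.

Lemma strand_weight_cocycle a : cocycle p (fun x => (strand_weight a x).1).
Proof. by move=> x y i; rewrite gmulfM affineM1 strand_weight2. Qed.

Lemma cocycle1 (f : {multiplicative G -> 'S_n}) c : cocycle f c -> forall i, c 1 i = 0%R.
Proof.
move=> fc i; apply: (@addrI _ (c 1 i)); rewrite addr0.
by have := fc 1 1 i; rewrite mulg1 hom1 perm1.
Qed.

Lemma cocycle_eq0 (f : {multiplicative G -> 'S_n}) c : cocycle f c ->
  (forall g i, c (pres_gen R g) i = 0%R) -> forall x i, c x i = 0%R.
Proof.
move=> fc c0; apply: (pres_ind (P := fun x : G => forall i, c x i = 0%R)) => [|x g cx|x g cx] i.
- exact: cocycle1 fc i.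
- by rewrite fc cx c0 addr0.
rewrite fc cx add0r -[LHS]addr0.
have := fc (pres_gen R g)^-1 (pres_gen R g) (f x i).
by rewrite c0 mulVg (cocycle1 fc).
Qed.

(* The cocycles of S_n acting on Q^n through p contain the combinations of the
   three strand weights and of the n coboundaries, a space of dimension n + 2. *)
Lemma cocycle_dimension (phi psi : {multiplicative G -> G}) (e : 'I_n.+1 -> G * 'I_n) :
  cancel psi phi ->
  ~ (forall c, cocycle (p \o phi) c -> (forall s, c (e s).1 (e s).2 = 0%R) ->
     forall x i, c x i = 0%R).
Proof.
move=> psiK det.
have n0 : 0 < n by apply: ltn_trans n_gt2.
pose o0 := Ordinal n0.
pose ct (t : 'I_(3 + n)) (x : G) (i : 'I_n) : rat :=
  match split t with
  | inl a => (strand_weight a x).1 i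
  | inr j => ((p x i == j)%:R - (i == j)%:R)%R
  end.
(* The n coboundaries add up to 0, so the last column normalizes B by B o0 = 0. The n + 3 rows still
   outnumber the n + 2 columns, which gives a nonzero combination vanishing at all the e s. *)
pose M := (\matrix_(t < 3 + n, s < n.+1 + 1) match split s with
  | inl s => ct t (phi (e s).1) (e s).2
  | inr _ => (t == rshift 3 o0)%:R%R end)%R.
have /rowV0Pn[th thM th0] : kermx M != 0%R.
  rewrite -mxrank_eq0 mxrank_ker -lt0n subn_gt0.
  by apply: leq_ltn_trans (rank_leq_col _) _; lia.
have {}thM : (th *m M)%R = 0%R by apply/sub_kermxP.
pose u a := th 0%R (lshift n a); pose B j := th 0%R (rshift 3 j).
pose C x i : rat := (\sum_a u a * (strand_weight a x).1 i + (B (p x i) - B i))%R.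
have CE x i : C x i = (\sum_t th 0 t * ct t x i)%R.
  rewrite big_split_ord /=; congr (_ + _)%R.
    by apply: eq_bigr => a _; rewrite /ct (unsplitK (inl a)).
  under eq_bigr => j _ do rewrite /ct (unsplitK (inr j)) mulrBr.
  rewrite big_split /= sumrN; congr (_ - _)%R.
    by rewrite (bigD1 (p x i)) //= eqxx mulr1 big1 ?addr0 // => j /negPf; rewrite eq_sym => ->; rewrite mulr0.
  by rewrite (bigD1 i) //= eqxx mulr1 big1 ?addr0 // => j /negPf; rewrite eq_sym => ->; rewrite mulr0.
have Cc : cocycle p C.
  move=> x y i; rewrite /C gmulfM permM.
  under eq_bigr => a _ do rewrite (strand_weight_cocycle a) mulrDr.
  by rewrite big_split /=; lra.
have C0 x i : C x i = 0%R.
  rewrite -(psiK x); move: (psi x) i; apply: det => [y z i|s].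
    by rewrite gmulfM Cc.
  rewrite CE; transitivity ((th *m M) 0 (lshift 1 s))%R; last by rewrite thM mxE.
  rewrite [RHS]mxE; by apply: eq_bigr => t _; rewrite mxE (unsplitK (inl s)).
have B0 : B o0 = 0%R.
  transitivity ((th *m M) 0 (rshift n.+1 0))%R; last by rewrite thM mxE.
  rewrite [RHS]mxE.
  rewrite (bigD1 (rshift 3 o0)) //= mxE (unsplitK (inr _)) eqxx mulr1.
  rewrite big1 ?addr0 // => t /negPf tn.
  by rewrite mxE (unsplitK (inr _)) tn mulr0.
have n1 : 0 < n.-1 by lia.
(* On the pure element s_0 v_0 the coboundaries vanish, and its first three coordinates separate the
   three strand weights. *)
pose i0 := Ordinal n1; pose x := pres_gen R (sigma i0) * pres_gen R (virt i0).
have px : p x = 1 by rewrite gmulfM projP_s projP_v tau2.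
have wx b (i : 'I_n) : i < 3 -> (strand_weight b x).1 i = ((b : nat) == i)%:R%R.
  rewrite /x gmulfM affineM1 !strand_weight_gen !ffunE addr0 -!val_eqE /= /w3.
  by case: i => -[|[|[|]]].
have u0 a : u a = 0%R.
  have an : a < n by apply: leq_trans n_gt2; rewrite -[3]/(2.+1) ltn_ord.
  rewrite -[RHS](C0 x (Ordinal an)) /C px perm1 subrr addr0.
  under eq_bigr => b _ do rewrite wx ?ltn_ord //=.
  rewrite (bigD1 a) //= eqxx mulr1 big1 ?addr0 // => b /negPf.
  by rewrite -val_eqE /= => ->; rewrite mulr0.
(* Only a coboundary remains; on an element above the transposition (0 j), it equals B j - B o0 at
   the point 0. *)
have BE j : B j = 0%R.
  have [y py] := projP_surj R_UVB (tperm o0 j).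
  have := C0 y o0; rewrite /C py tpermL B0 subr0 => <-.
  by rewrite big1 ?add0r // => a _; rewrite u0 mul0r.
case/eqP: th0; apply/rowP => t; rewrite mxE -(splitK t).
by case: (split t) => j /=; [apply: u0|apply: BE].
Qed.

End Cocycle.

Section Normalized.
Variable k : nat.
Notation n := k.+2.
Variable R : word (VBgen n) -> word (VBgen n) -> Prop.
Variable f : {multiplicative presented R -> 'S_n}.
Variable c : presented R -> 'I_n -> rat.
Hypothesis fc : cocycle f c.
Variables (q : 'S_n) (t : bool * nat -> seq nat).
Hypothesis qt : forall l, l.2 <= k ->
  code (q * f (pres_gen R (letter_gen k l)) * q^-1) = t l.

(** Relabelling the coordinates by q makes f act through the fixed table t, so one system of
    equations serves a whole conjugacy class. *)
Definition letter_val (l : bool * nat) (i : nat) : rat :=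
  c (pres_gen R (letter_gen k l)) (q (inord i)).

Fixpoint word_val (d : bool * nat -> nat -> rat) (w : seq (bool * nat)) (i : nat) : rat :=
  if w is l :: w' then (d l i + word_val d w' (nth 0 (t l) i))%R else 0%R.

Lemma word_valE w i : all (fun l => l.2 <= k) w -> i < n ->
  c (word_prod R w) (q (inord i)) = word_val letter_val w i.
Proof.
elim: w i => [|l w IHw] i /=; first by rewrite /word_prod big_nil (cocycle1 fc).
case/andP=> lk wk lt_in; rewrite /word_prod big_cons fc -/(word_prod R w).
have -> : f (pres_gen R (letter_gen k l)) (q (inord i)) = q (inord (nth 0 (t l) i)).
  rewrite -(qt lk) -[X in nth 0 _ X](inordK lt_in) nth_code inord_val.
  by rewrite !permM permKV.
rewrite IHw // -(qt lk) -[X in nth 0 _ X](inordK lt_in) nth_code; exact: ltn_ord.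
Qed.

(** The nested conjunction reduces, for concrete relations, to explicit linear equations suitable
    for [lra]. *)
Definition rel_equations (d : bool * nat -> nat -> rat)
    (rs : seq (seq (bool * nat) * seq (bool * nat))) : Prop :=
  foldr (fun r P => foldr (fun i Q => word_val d r.1 i = word_val d r.2 i /\ Q) P (iota 0 n))
    True rs.

Lemma rel_equationsP rs :
  all (fun r => all (fun l => l.2 <= k) (r.1 ++ r.2)) rs ->
  foldr (fun r P => word_prod R r.1 = word_prod R r.2 /\ P) True rs ->
  rel_equations letter_val rs.
Proof.
elim: rs => // -[u w] rs IHrs /andP[/= + rsk] [e /(IHrs rsk)]; rewrite all_cat => /andP[uk wk].
change (rel_equations letter_val rs -> foldr (fun i Q =>
  word_val letter_val u i = word_val letter_val w i /\ Q) (rel_equations letter_val rs) (iota 0 n)).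
have : all (fun i => i < n) (iota 0 n) by apply/allP => i; rewrite mem_iota.
move: (iota 0 n) (rel_equations _ _) => s P; elim: s => //= i s IHs /andP[lt_in sn] HP.
by split; [rewrite -!word_valE // e|apply: IHs].
Qed.

Lemma letter_val_eq0 : (forall b j i, j <= k -> i < n -> letter_val (b, j) i = 0%R) ->
  forall x i, c x i = 0%R.
Proof.
move=> d0; apply: (cocycle_eq0 fc) => g i.
have -> : i = q (inord (q^-1 i)) by rewrite inord_val permKV.
case: g => j; [have := d0 false j|have := d0 true j]; rewrite /letter_val /letter_gen /=;
  by rewrite inord_val; apply; [rewrite -ltnS; apply: ltn_ord|apply: ltn_ord].
Qed.

End Normalized.

(* Tables of the images of the sigma and of the virtual generators: for S_3, the
   surjections of WB_3, and for S_4, those of VB_4, whose kernel is neither that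
   of projP nor that of piK, up to conjugacy. *)
Definition bad3 : seq (seq (seq nat) * seq (seq nat)) :=
  [:: ([:: [:: 0; 2; 1]; [:: 2; 1; 0]], [:: [:: 1; 0; 2]; [:: 0; 2; 1]]);
      ([:: [:: 2; 1; 0]; [:: 1; 0; 2]], [:: [:: 1; 0; 2]; [:: 0; 2; 1]]);
      ([:: [:: 2; 0; 1]; [:: 2; 0; 1]], [:: [:: 1; 0; 2]; [:: 0; 2; 1]]);
      ([:: [:: 0; 2; 1]; [:: 0; 2; 1]], [:: [:: 1; 0; 2]; [:: 1; 0; 2]])]%N.

Definition bad4 : seq (seq (seq nat) * seq (seq nat)) :=
  [:: ([:: [:: 0; 1; 3; 2]; [:: 3; 1; 2; 0]; [:: 1; 0; 2; 3]],
       [:: [:: 1; 0; 2; 3]; [:: 0; 2; 1; 3]; [:: 0; 1; 3; 2]]);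
      ([:: [:: 0; 1; 3; 2]; [:: 3; 1; 2; 0]; [:: 0; 1; 3; 2]],
       [:: [:: 1; 0; 2; 3]; [:: 0; 2; 1; 3]; [:: 1; 0; 2; 3]])]%N.

Definition table_of (B : seq (seq nat) * seq (seq nat)) : bool * nat -> seq nat :=
  letter_code (nth [::] B.1) (nth [::] B.2).

(** The relations of WB_3, with the forbidden one last; [rels4] lists those of VB_4. *)
Definition rels3 : seq (seq (bool * nat) * seq (bool * nat)) :=
  [:: ([:: S 0; S 1; S 0], [:: S 1; S 0; S 1]); ([:: V 0; V 1; V 0], [:: V 1; V 0; V 1]);
      ([:: V 0; V 1; S 0], [:: S 1; V 0; V 1]); ([:: V 0; V 0], [::]); ([:: V 1; V 1], [::]);
      ([:: V 0; S 1; S 0], [:: S 1; S 0; V 1])].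

Definition rels4 : seq (seq (bool * nat) * seq (bool * nat)) :=
  [:: ([:: S 0; S 1; S 0], [:: S 1; S 0; S 1]); ([:: S 1; S 2; S 1], [:: S 2; S 1; S 2]);
      ([:: V 0; V 1; V 0], [:: V 1; V 0; V 1]); ([:: V 1; V 2; V 1], [:: V 2; V 1; V 2]);
      ([:: V 0; V 1; S 0], [:: S 1; V 0; V 1]); ([:: V 1; V 2; S 1], [:: S 2; V 1; V 2]);
      ([:: V 0; V 0], [::]); ([:: V 1; V 1], [::]); ([:: V 2; V 2], [::]);
      ([:: S 0; S 2], [:: S 2; S 0]); ([:: V 0; V 2], [:: V 2; V 0]);
      ([:: S 0; V 2], [:: V 2; S 0]); ([:: S 2; V 0], [:: V 0; S 2])].

Local Ltac split_hyps := repeat match goal with H : _ /\ _ |- _ => destruct H end.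

Local Ltac clear_trivial := repeat match goal with
  | H : context [(0 + ?x)%R] |- _ => rewrite (add0r x) in H
  | H : context [(?x + 0)%R] |- _ => rewrite (addr0 x) in H
  | H : ?x = ?x |- _ => clear H
  end.

(* The virtual letters come first: their relations do not involve the others,
   which keeps the linear systems small. *)
Local Ltac solve_vanish d zeros :=
  assert (zeros true);
  [ repeat match goal with H : context [d (false, _)] |- _ => clear H end;
    repeat split; lra | ];
  match goal with H : zeros true |- _ => rewrite /zeros in H end;
  repeat match goal with H : and3 _ _ _ |- _ => case: H => ? ? ?
    | H : and4 _ _ _ _ |- _ => case: H => ? ? ? ?
    | H : _ /\ _ |- _ => case: H => ? ? end;
  (repeat match goal with Z : d (true, ?j) ?i = 0%R, H : context [d (true, ?j) ?i] |- _ =>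
    lazymatch type of H with d (true, j) i = 0%R => fail | _ => rewrite Z in H end end);
  clear_trivial; case; repeat split; first [assumption | lra].

(* Coordinates that determine a cocycle for each table of bad3; eval4 plays the
   same role for bad4. *)
Definition eval3 : seq ((bool * nat) * nat) :=
  [:: (S 1, 1%N); (S 1, 2); (V 0, 1%N); (V 1, 2)].

Lemma bad3_vanish B (d : bool * nat -> nat -> rat) : B \in bad3 ->
  rel_equations 1 (table_of B) d rels3 ->
  (forall e, e \in eval3 -> d e.1 e.2 = 0%R) ->
  forall b j i, j <= 1 -> i < 3 -> d (b, j) i = 0%R.
Proof.
move=> Bbad E Z.
have z1 : d (S 1) 1%N = 0%R by apply: (Z (S 1, 1%N)).
have z2 : d (S 1) 2 = 0%R by apply: (Z (S 1, 2)).
have z3 : d (V 0) 1%N = 0%R by apply: (Z (V 0, 1%N)).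
have z4 : d (V 1) 2 = 0%R by apply: (Z (V 1, 2)).
suff all0 : forall b, [/\ d (b, 0%N) 0%N = 0%R, d (b, 0%N) 1%N = 0%R & d (b, 0%N) 2 = 0%R] /\
    [/\ d (b, 1%N) 0%N = 0%R, d (b, 1%N) 1%N = 0%R & d (b, 1%N) 2 = 0%R].
  by move=> b j i; have [[? ? ?] [? ? ?]] := all0 b; case: j i => [|[|j]] [|[|[|i]]].
move: E; move: Bbad; rewrite !inE => /or4P[] /eqP->;
  rewrite /rel_equations /table_of /letter_code /=; intro E; split_hyps;
  by case; repeat split; lra.
Qed.

Definition eval4 (B : seq (seq nat) * seq (seq nat)) : seq ((bool * nat) * nat) :=
  if nth [::] B.2 2 == [:: 0; 1; 3; 2]%N
  then [:: (S 2, 1%N); (S 2, 3); (V 0, 1%N); (V 1, 2); (V 2, 3)]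
  else [:: (S 2, 1%N); (S 2, 2); (S 2, 3); (V 1, 2); (V 2, 1%N)].

(** Five coordinates determine the cocycle, so the cocycles form a space of dimension at most 5 = n
    + 1. *)
Lemma bad4_vanish B (d : bool * nat -> nat -> rat) : B \in bad4 ->
  rel_equations 2 (table_of B) d rels4 ->
  (forall e, e \in eval4 B -> d e.1 e.2 = 0%R) ->
  forall b j i, j <= 2 -> i < 4 -> d (b, j) i = 0%R.
Proof.
move=> Bbad E Z.
have {}Z : foldr (fun e P => d e.1 e.2 = 0%R /\ P) True (eval4 B).
  elim: (eval4 B) Z => //= e s IHs Z; split; first by apply: Z; rewrite inE eqxx.
  by apply: IHs => x xs; apply: Z; rewrite inE xs orbT.
pose zeros4 b := [/\ d (b, 0%N) 0%N = 0%R, d (b, 0%N) 1%N = 0%R, d (b, 0%N) 2 = 0%R & d (b, 0%N) 3 = 0%R] /\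
    [/\ d (b, 1%N) 0%N = 0%R, d (b, 1%N) 1%N = 0%R, d (b, 1%N) 2 = 0%R & d (b, 1%N) 3 = 0%R] /\
    [/\ d (b, 2) 0%N = 0%R, d (b, 2) 1%N = 0%R, d (b, 2) 2 = 0%R & d (b, 2) 3 = 0%R].
suff all0 : forall b, zeros4 b.
  by move=> b j i; have [[? ? ? ?] [[? ? ? ?] [? ? ? ?]]] := all0 b; case: j i => [|[|[|j]]] [|[|[|[|i]]]].
move: E Z; move: Bbad; rewrite !inE => /orP[] /eqP->;
  rewrite /rel_equations /table_of /letter_code /eval4 /=; intros E Z; split_hyps.
solve_vanish d zeros4.
solve_vanish d zeros4.
Qed.

Definition conjugate_check (k : nat) (bad : seq (seq (seq nat) * seq (seq nat)))
    (fs fv : nat -> seq nat) : bool :=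
  has (fun B => has (fun P => all (fun i =>
      (P ** fs i ** code_inv P == table_of B (false, i)) &&
      (P ** fv i ** code_inv P == table_of B (true, i))) (iota 0 k.+1))
    (codes k.+2)) bad.

Definition class3_check (a b t : seq nat) : bool :=
  let fs := s3_table a b t in let fv := v3_table a b in
  if vb_check 2 fs fv then
    if forbidden_check 2 fs fv then
      if surj_check 1 fs fv then
        if all (fun i => fs i == fv i) (iota 0 2) then true else
        conjugate_check 1 bad3 fs fv
      else true
    else true
  else true.

Lemma class3_check_all :
  all (fun a => all (fun b => all (class3_check a b) (codes 3)) (codes 3)) (codes 3).
Proof. by vm_compute. Qed.

Definition class4_check (a b d t : seq nat) : bool :=
  let fs := s4_table a b d t in let fv := v4_table a b d in
  if vb_check 3 fs fv then
    if surj_check 2 fs fv then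
      if t == iota 0 4 then true else
      if all (fun i => fs i == fv i) (iota 0 3) then true else
      conjugate_check 2 bad4 fs fv
    else true
  else true.

Lemma class4_check_all : all4 class4_check.
Proof. by vm_compute. Qed.

Lemma s3_tableP (R : word (VBgen 3) -> word (VBgen 3) -> Prop)
  (f : {multiplicative presented R -> 'S_3}) :
  (forall u w, VB_rel u w -> R u w) ->
  exists a b t, [/\ a \in codes 3, b \in codes 3, t \in codes 3,
    forall i : 'I_2, code (f (pres_gen R (@sigma 3 i))) = s3_table a b t i &
    forall i : 'I_2, code (f (pres_gen R (@virt 3 i))) = v3_table a b i].
Proof.
move=> VB_R; pose o0 := @Ordinal 2 0 isT; pose o1 := @Ordinal 2 1 isT.
have fr := hom_vb_rels VB_R f.
exists (code (f (pres_gen R (@virt 3 o0)))), (code (f (pres_gen R (@virt 3 o1)))),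
  (code (f (pres_gen R (@sigma 3 o0)))).
have o (i : 'I_2) : i = o0 \/ i = o1.
  by case: i => -[|[|//]] lti; [left|right]; apply: val_inj.
split; try exact: code_perms.
  move=> i; case: (o i) => -> //.
  rewrite /s3_table /= -!codeM; congr code.
  exact: (vb_next (n := 3) (i := o0) (j := o1) fr erefl).
by move=> i; case: (o i) => ->.
Qed.

Lemma s4_tableP (R : word (VBgen 4) -> word (VBgen 4) -> Prop)
  (f : {multiplicative presented R -> 'S_4}) (P : seq nat -> seq nat -> seq nat -> seq nat -> bool) :
  (forall u w, VB_rel u w -> R u w) -> all4 P ->
  exists a b d t, [/\ P a b d t,
    forall i : 'I_3, code (f (pres_gen R (@sigma 4 i))) = s4_table a b d t i &
    forall i : 'I_3, code (f (pres_gen R (@virt 4 i))) = v4_table a b d i].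
Proof.
move=> VB_R; pose o0 := @Ordinal 3 0 isT; pose o1 := @Ordinal 3 1 isT; pose o2 := @Ordinal 3 2 isT.
have fr := hom_vb_rels VB_R f.
pose v i := f (pres_gen R (@virt 4 i)); pose s i := f (pres_gen R (@sigma 4 i)).
move=> PA; exists (code (v o0)), (code (v o1)), (code (v o2)), (code (s o0)).
have o (i : 'I_3) : [\/ i = o0, i = o1 | i = o2].
  by case: i => -[|[|[|//]]] lti; [constructor 1|constructor 2|constructor 3]; apply: val_inj.
split.
- have := allP PA _ (code_perms (v o0)); rewrite -codeM (vb_vinvol fr o0) code1 eqxx.
  move=> /allP/(_ _ (code_perms (v o1))); rewrite -!codeM.
  rewrite (vb_vbraid fr (i := o0) (j := o1)) // eqxx.
  move=> /allP/(_ _ (code_perms (v o2))); rewrite -!codeM.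
  rewrite (vb_vbraid fr (i := o1) (j := o2)) // eqxx.
  rewrite (vb_vcomm fr (i := o0) (j := o2)) // eqxx.
  by move=> /allP/(_ _ (code_perms (s o0))).
- move=> i; case: (o i) => -> //; rewrite /s4_table /= -!codeM; congr code.
    exact: (vb_next (n := 4) (i := o0) (j := o1) fr erefl).
  have e1 := vb_next (n := 4) (i := o0) (j := o1) fr erefl.
  have e2 := vb_next (n := 4) (i := o1) (j := o2) fr erefl.
  by rewrite /= in e1 e2; rewrite e2 e1.
by move=> i; case: (o i) => ->.
Qed.

Lemma killed_next n (R : word (VBgen n) -> word (VBgen n) -> Prop)
  (f : {multiplicative presented R -> 'S_n}) (i0 : 'I_n.-1) :
  (forall u w, VB_rel u w -> R u w) -> i0 = 0%N :> nat ->
  f (pres_gen R (sigma i0)) = 1 -> forall i, f (pres_gen R (sigma i)) = 1.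
Proof.
move=> VB_R e0 f0 [j jn]; have fr := hom_vb_rels VB_R f.
elim: j jn => [|j IHj] jn; first by have -> : Ordinal jn = i0 by apply: val_inj.
rewrite [LHS](vb_next (i := Ordinal (ltnW jn)) (j := Ordinal jn) fr) //=.
rewrite IHj mulg1 -mulgA; have V2 := vb_vinvol fr; rewrite /= in V2.
by rewrite -!mulgA [X in _ * X]mulgA V2 mul1g V2.
Qed.

(** By enumeration, each surjection that does not kill the sigma_i has a lift contradicting
    centrality. *)
Lemma commutator_central_small (k : nat) (f : {multiplicative VB k.+2 -> 'S_k.+2}) :
  k.+2 = 3 \/ k.+2 = 4 -> (forall g, exists x, f x = g) -> commutator_central f ->
  forall i, f (pres_gen _ (sigma i)) = 1.
Proof.
move=> n34 f_surj fC; have : k = 1%N \/ k = 2 by lia.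
case=> ek; subst k.
  have [a [b [t [aP bP tP fsE fvE]]]] := s3_tableP f (fun _ _ => id).
  have := lift3_check_all => /allP/(_ _ aP)/allP/(_ _ bP)/allP/(_ _ tP).
  rewrite /lift3_check (vb_checkP (n := 3) fsE fvE).2; last exact: (hom_vb_rels (fun _ _ => id) f).
  rewrite (surj_checkP n34 f_surj fsE fvE); case: eqP => [t1 _|_].
    apply: (@killed_next 3 _ f (@Ordinal 2 0 isT) (fun _ _ => id) erefl).
    by apply: (@code_inj 3); rewrite fsE code1.
  case/hasP=> A _ /hasP[B _ /hasP[T _ /(lift_not_commutator_central _ fsE fvE)]].
  by case.
have [a [b [d [t [P fsE fvE]]]]] := s4_tableP f (fun _ _ => id) lift4_check_all.
move: P; rewrite /lift4_check (vb_checkP (n := 4) fsE fvE).2; last exact: (hom_vb_rels (fun _ _ => id) f).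
rewrite (surj_checkP n34 f_surj fsE fvE); case: eqP => [t1 _|_].
  apply: (@killed_next 4 _ f (@Ordinal 3 0 isT) (fun _ _ => id) erefl).
  by apply: (@code_inj 4); rewrite fsE code1.
case/hasP=> A _ /hasP[B _ /hasP[D _ /hasP[T _ /(lift_not_commutator_central on_pairings_morph fsE fvE)]]].
by case.
Qed.

(** * Characteristic kernels *)

Section Bad.
Variable k : nat.
Notation n := k.+2.
Variable R : word (VBgen n) -> word (VBgen n) -> Prop.
Hypothesis R_UVB : forall u w, R u w -> UVB_rel u w.
Variables phi psi : {multiplicative presented R -> presented R}.
Hypothesis psiK : cancel psi phi.
Notation f := (projP R_UVB \o phi).

(** For a table in [bad], the n + 1 coordinates [ev B] determine every cocycle of p o phi, against
    [cocycle_dimension]. *)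
Lemma conjugate_contra bad rs (ev : seq (seq nat) * seq (seq nat) -> seq ((bool * nat) * nat))
    (fs fv : nat -> seq nat) :
  2 < n ->
  (forall i : 'I_k.+1, code (f (pres_gen R (@sigma n i))) = fs i) ->
  (forall i : 'I_k.+1, code (f (pres_gen R (@virt n i))) = fv i) ->
  conjugate_check k bad fs fv ->
  all (fun r => all (fun l => l.2 <= k) (r.1 ++ r.2)) rs ->
  foldr (fun r P => word_prod R r.1 = word_prod R r.2 /\ P) True rs ->
  (forall B, B \in bad -> size (ev B) = n.+1) ->
  (forall B (d : bool * nat -> nat -> rat), B \in bad ->
     rel_equations k (table_of B) d rs ->
     (forall e, e \in ev B -> d e.1 e.2 = 0%R) ->
     forall b j i, j <= k -> i < n -> d (b, j) i = 0%R) ->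
  False.
Proof.
move=> n3 fsE fvE /hasP[B Bbad /hasP[P Pn /allP PB]] rsk rsE evB vanish.
have [q qP] := code_onto Pn.
have qt l : l.2 <= k -> code (q * f (pres_gen R (letter_gen k l)) * q^-1) = table_of B l.
  case: l => b j /= jk; rewrite !codeM codeV qP.
  have /PB/andP[/eqP e1 /eqP e2] : j \in iota 0 k.+1 by rewrite mem_iota.
  by case: b; [rewrite -[letter_gen k _]/(@virt n (inord j)) fvE
    |rewrite -[letter_gen k _]/(@sigma n (inord j)) fsE]; rewrite inordK.
(* The default (S 0, 0) is never reached, as [ev B] has n + 1 entries. *)
pose e (s : 'I_n.+1) := let x := nth (S 0, 0) (ev B) s in
  (pres_gen R (letter_gen k x.1), q (inord x.2)).
apply: (cocycle_dimension (R_UVB := R_UVB) n3 (e := e) psiK) => c fc ce.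
apply: (letter_val_eq0 (k := k) (R := R) (f := hom_of (gmulfM (s := f))) (c := c) fc (q := q)).
apply: (vanish B) => //.
  exact: (rel_equationsP (f := hom_of (gmulfM (s := f))) fc qt).
move=> x xe; have := ce (inord (index x (ev B))).
by rewrite /e inordK ?nth_index // -(evB B Bbad) index_mem.
Qed.

End Bad.

Lemma comp_projP_surj n (R : word (VBgen n) -> word (VBgen n) -> Prop)
  (R_UVB : forall u w, R u w -> UVB_rel u w)
  (phi psi : {multiplicative presented R -> presented R}) :
  cancel psi phi -> forall g, exists x, (projP R_UVB \o phi) x = g.
Proof.
move=> psiK g; have [x <-] := projP_surj R_UVB g.
by exists (psi x); rewrite /= psiK.
Qed.

Lemma word_prod_seq k (R : word (VBgen k.+2) -> word (VBgen k.+2) -> Prop) :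
  (forall a b, word_prod R [:: a; b] =
     pres_gen R (letter_gen k a) * pres_gen R (letter_gen k b)) /\
  (forall a b c, word_prod R [:: a; b; c] =
     pres_gen R (letter_gen k a) * pres_gen R (letter_gen k b) * pres_gen R (letter_gen k c)) /\
  word_prod R [::] = 1.
Proof.
by rewrite /word_prod; split; [|split] => *;
  rewrite ?big_cons big_nil ?mulg1 ?mulgA.
Qed.

Section Class.
Local Notation so n R i := (pres_gen R (@sigma n i)).
Local Notation vo n R i := (pres_gen R (@virt n i)).

Lemma class4 (R : word (VBgen 4) -> word (VBgen 4) -> Prop)
  (VB_R : forall u w, VB_rel u w -> R u w) (R_UVB : forall u w, R u w -> UVB_rel u w)
  (phi psi : {multiplicative presented R -> presented R}) :
  cancel psi phi ->
  let f := projP R_UVB \o phi in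
  (forall i, f (pres_gen R (sigma i)) = 1) \/
  (forall i, f (pres_gen R (sigma i)) = f (pres_gen R (virt i))).
Proof.
move=> psiK f.
have [a [b [d [t [P fsE fvE]]]]] := s4_tableP f VB_R class4_check_all.
move: P; rewrite /class4_check (vb_checkP (n := 4) fsE fvE).2; last exact: (hom_vb_rels VB_R f).
rewrite (surj_checkP (k := 2) (or_intror erefl) (comp_projP_surj R_UVB psiK) fsE fvE).
case: eqP => [t1 _|_].
  left; apply: (@killed_next 4 _ f (@Ordinal 3 0 isT) VB_R erefl).
  by apply: (@code_inj 4); rewrite fsE code1.
case: allP => [eq_sv _|_ chk].
  right=> i; apply: (@code_inj 4); rewrite fsE fvE; apply/eqP/eq_sv.
  by rewrite mem_iota /= add0n ltn_ord.
case: (conjugate_contra (rs := rels4) (ev := eval4) psiK isT fsE fvE chk isT).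
- have gr := hom_vb_rels VB_R (idfun : {multiplicative presented R -> presented R}).
  have [w2 [w3 w0]] := word_prod_seq (k := 2) R.
  rewrite /= !w2 !w3 w0 /letter_gen /=.
  have e01 : (inord 1 : 'I_3) = (inord 0 : 'I_3).+1 :> nat by rewrite !inordK.
  have e12 : (inord 2 : 'I_3) = (inord 1 : 'I_3).+1 :> nat by rewrite !inordK.
  have f02 : @far 4 (inord 0) (inord 2) by rewrite /far !inordK.
  have f20 : @far 4 (inord 2) (inord 0) by rewrite /far !inordK.
  rewrite (vb_braid gr e01) (vb_braid gr e12) (vb_vbraid gr e01) (vb_vbraid gr e12).
  rewrite (vb_mixed gr e01) (vb_mixed gr e12) !(vb_vinvol gr) (vb_comm gr f02).
  by rewrite (vb_vcomm gr f02) (vb_mcomm gr f02) (vb_mcomm gr f20).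
- by move=> B; rewrite !inE => /orP[] /eqP->.
- by move=> B dd; apply: bad4_vanish.
Qed.

Lemma forbidden_rel n (R : word (VBgen n) -> word (VBgen n) -> Prop)
  (W_R : forall u w, WB_rel u w -> R u w) (H : groupType) (f : {multiplicative presented R -> H})
  (i j : 'I_n.-1) : j = i.+1 :> nat ->
  f (vo n R i) * f (so n R j) * f (so n R i) = f (so n R j) * f (so n R i) * f (vo n R j).
Proof.
move=> /WB_forbidden/W_R/(pres_hom_rel f).
by rewrite /word_eval !big_cons !big_nil /= !mulg1 !mulgA.
Qed.

(** Given the forbidden relation, the enumeration leaves only this case and the tables of [bad3],
    which [conjugate_contra] excludes. *)
Lemma class3 (R : word (VBgen 3) -> word (VBgen 3) -> Prop)
  (W_R : forall u w, WB_rel u w -> R u w) (R_UVB : forall u w, R u w -> UVB_rel u w)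
  (phi psi : {multiplicative presented R -> presented R}) :
  cancel psi phi ->
  let f := projP R_UVB \o phi in
  forall i, f (pres_gen R (sigma i)) = f (pres_gen R (virt i)).
Proof.
move=> psiK f; have VB_R u w (r : VB_rel u w) : R u w := W_R _ _ (WB_VB r).
have [a [b [t [aP bP tP fsE fvE]]]] := s3_tableP f VB_R.
have := class3_check_all => /allP/(_ _ aP)/allP/(_ _ bP)/allP/(_ _ tP).
rewrite /class3_check (vb_checkP (n := 3) fsE fvE).2; last exact: (hom_vb_rels VB_R f).
have -> : forbidden_check 2 (s3_table a b t) (v3_table a b).
  apply/allP => i; rewrite mem_iota => /andP[_ i2].
  apply/allP => j; rewrite mem_iota => /andP[_ j2].
  rewrite -[i]/(val (Ordinal i2)) -[j]/(val (Ordinal j2)) -!fsE -!fvE -!codeM.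
  by apply/implyP => /eqP e; rewrite (forbidden_rel W_R f e).
rewrite (surj_checkP (k := 1) (or_introl erefl) (comp_projP_surj R_UVB psiK) fsE fvE).
case: allP => [eq_sv _|_ chk].
  move=> i; apply: (@code_inj 3); rewrite fsE fvE; apply/eqP/eq_sv.
  by rewrite mem_iota /= add0n ltn_ord.
case: (conjugate_contra (rs := rels3) (ev := fun=> eval3) psiK isT fsE fvE chk isT).
- have gr := hom_vb_rels VB_R (idfun : {multiplicative presented R -> presented R}).
  have [w2 [w3 w0]] := word_prod_seq (k := 1) R.
  rewrite /= !w2 !w3 w0 /letter_gen /=.
  have e01 : (inord 1 : 'I_2) = (inord 0 : 'I_2).+1 :> nat by rewrite !inordK.
  have := forbidden_rel W_R (idfun : {multiplicative presented R -> presented R}) (i := inord 0) (j := inord 1) e01.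
  rewrite (vb_braid gr e01) (vb_vbraid gr e01) (vb_mixed gr e01) !(vb_vinvol gr).
  by move=> /= ->.
- by [].
- by move=> B dd; apply: bad3_vanish.
Qed.

End Class.

Section Pure.
Variables (n : nat) (R : word (VBgen n) -> word (VBgen n) -> Prop).
Hypothesis VB_R : forall u w, VB_rel u w -> R u w.
Hypothesis R_UVB : forall u w, R u w -> UVB_rel u w.
Notation p := (projP R_UVB).

Lemma pure_characteristic :
  3 < n \/ n = 3 /\ (forall u w, WB_rel u w -> R u w) ->
  (forall f : {multiplicative presented R -> 'S_n}, (forall g, exists x, f x = g) ->
     (forall i, f (pres_gen R (sigma i)) = 1) -> commutator_central f) ->
  is_characteristic (group_kernel p).
Proof.
move=> hn killed; apply/characteristic_kernelP => phi bphi x px.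
have [psi phiK psiK] := inverse_hom bphi.
have fS := comp_projP_surj R_UVB psiK.
pose f : {multiplicative presented R -> 'S_n} := p \o phi.
(* Otherwise f, and with it p = f o psi, would be commutator central. *)
have not_killed : ~ forall i, f (pres_gen R (sigma i)) = 1.
  move=> f1; have n3 : 2 < n by lia.
  apply: (projP_not_commutator_central (R_UVB := R_UVB) n3).
  apply: (commutator_central_eq (f := f \o psi)) => [y|]; first by rewrite /= psiK.
  exact: (commutator_central_aut psiK phiK (killed f fS f1)).
have [//|fsv] : (forall i, f (pres_gen R (sigma i)) = 1) \/
    (forall i, f (pres_gen R (sigma i)) = f (pres_gen R (virt i))).
  case: (ltnP 4 n) => n4; first exact: (surj_killed_or_equal VB_R R_UVB fS).
  have n34 : n = 4 \/ n = 3 /\ (forall u w, WB_rel u w -> R u w) by case: hn; [lia|right].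
  case: n34 => [e|[e W_R]].
    by clear -psiK VB_R e; subst n; apply: (class4 VB_R R_UVB psiK).
  right; clear -psiK W_R e; subst n; exact: (@class3 R W_R R_UVB phi psi psiK).
apply: (sub_kernel VB_R (p := p) (f := f) _ _ px) => i; first exact: projP_v.
by right; rewrite projP_s projP_v.
Qed.

End Pure.

(** Such an f has the same kernel as [piK], and centrality depends only on the kernel. *)
Lemma killed_commutator_central n (f : {multiplicative VB n -> 'S_n}) :
  2 < n -> (forall g, exists x, f x = g) ->
  (forall i, f (pres_gen _ (sigma i)) = 1) -> commutator_central f.
Proof.
move=> n3 fS f1; have id_R u w (r : VB_rel u w) : VB_rel (n := n) u w := r.
have kv i : piK (pres_gen (@VB_rel n) (virt i)) = tau i by apply: piK_gen.
have ks i : piK (pres_gen (@VB_rel n) (sigma i)) = 1 by apply: piK_gen.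
have sub := sub_kernel id_R kv (f := f) (fun i => or_introl (conj (ks i) (f1 i))).
have kS g : exists x, piK (n := n) x = g.
  have [t <-] := virt_surj (p := @piK n) kv g.
  by exists (vprod (fun i => pres_gen (@VB_rel n) (virt i)) t).
apply: (commutator_central_eq (f := @piK n)).
  by move=> x; split; [apply: sub|apply: kernel_eq].
exact: (commutator_central_killed id_R (ltnW n3) kv ks).
Qed.

(** Once the s_i are killed, the forbidden relation reads f (v i) = f (v j) for consecutive indices,
    and the image is abelian. *)
Lemma killed_welded n (R : word (VBgen n) -> word (VBgen n) -> Prop)
  (f : {multiplicative presented R -> 'S_n}) :
  (forall u w, WB_rel u w -> R u w) -> 2 < n -> (forall g, exists x, f x = g) ->
  ~ (forall i, f (pres_gen _ (sigma i)) = 1).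
Proof.
move=> W_R n3 fS f1; have n1 : 0 < n.-1 by lia.
have vE i : f (pres_gen R (virt i)) = f (pres_gen R (virt (Ordinal n1))).
  case: i => j jn; elim: j jn => [|j IHj] jn; first by congr (f (pres_gen R (virt _))); apply: val_inj.
  rewrite -(IHj (ltnW jn)).
  have := forbidden_rel W_R f (i := Ordinal (ltnW jn)) (j := Ordinal jn) erefl.
  by rewrite !f1 !mulg1 !mul1g => ->.
apply: (surj_gen_not_comm fS n3).
by case=> i [] j; rewrite -/(sigma _) -/(virt _) ?f1 ?vE //;
  apply: commute1 || apply/commute_sym/commute1.
Qed.

Lemma KB_characteristic n : 2 < n -> is_characteristic (KB n).
Proof.
move=> n3; apply/characteristic_kernelP => phi bphi x px.
have id_R u w (r : VB_rel u w) : VB_rel (n := n) u w := r.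
have R_UVB u w (r : VB_rel u w) : UVB_rel (n := n) u w := UVB_WB (WB_VB r).
have kv i : piK (pres_gen (@VB_rel n) (virt i)) = tau i by apply: piK_gen.
have ks i : piK (pres_gen (@VB_rel n) (sigma i)) = 1 by apply: piK_gen.
have [psi phiK psiK] := inverse_hom bphi.
have fS g : exists x, (@piK n \o phi) x = g.
  have [t <-] := virt_surj (p := @piK n) kv g.
  by exists (psi (vprod (fun i => pres_gen (@VB_rel n) (virt i)) t)); rewrite /= psiK.
have fC : commutator_central (@piK n \o phi).
  apply: (commutator_central_aut phiK psiK).
  exact: (commutator_central_killed id_R (ltnW n3) kv ks).
suff f1 i : (@piK n \o phi) (pres_gen _ (sigma i)) = 1.
  by apply: (sub_kernel id_R kv (f := @piK n \o phi) _ px) => i; left; split; [apply: ks|apply: f1].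
case: (ltnP 4 n) => n4; last first.
  have [k ek] : exists k, n = k.+2 by exists n.-2; lia.
  clear -fS fC n3 n4 ek; subst n.
  by apply: (commutator_central_small _ fS fC); lia.
have [f1|fsv] := surj_killed_or_equal id_R R_UVB fS n4; first exact: f1.
(* In the remaining case f (s i) = f (v i), the map [piK] o phi has the kernel of [projP], which is
   not commutator central. *)
case: (projP_not_commutator_central (R_UVB := R_UVB) n3).
apply: (commutator_central_eq _ fC) => y.
have sub : forall x, projP R_UVB x = 1 -> (@piK n \o phi) x = 1.
  apply: (sub_kernel id_R (projP_v R_UVB)) => j.
  by right; split; [rewrite projP_s projP_v|apply: fsv].
split; last exact: sub.
by apply: (kernel_eq (p := projP R_UVB) (f := @piK n \o phi)) => //; apply: projP_surj.
Qed.

(** * Automorphisms that move the kernels for n = 2 and n = 3 *)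

Lemma tau_neq1 n (i : 'I_n.-1) : tau i <> 1.
Proof.
move/(congr1 (fun s : 'S_n => s (strand_lo i))); rewrite tpermL perm1.
by move/(congr1 val) => /=; lia.
Qed.

(** For n = 2 the only relation is v^2 = 1, so this substitution defines an endomorphism, and it is
    an involution. *)
Lemma twist2 (R : word (VBgen 2) -> word (VBgen 2) -> Prop) :
  (forall u w, VB_rel u w -> R u w) -> (forall u w, R u w -> UVB_rel u w) ->
  exists2 phi : {multiplicative presented R -> presented R}, bijective phi &
    (forall i, phi (pres_gen R (@sigma 2 i)) =
       pres_gen R (@sigma 2 i) * pres_gen R (@virt 2 i)) /\
    (forall i, phi (pres_gen R (@virt 2 i)) = pres_gen R (@virt 2 i)).
Proof.
move=> VB_R R_UVB.
pose q (g : VBgen 2) : presented R := match g with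
  | inl i => pres_gen R (@sigma 2 i) * pres_gen R (@virt 2 i)
  | inr i => pres_gen R (@virt 2 i) end.
have v2 := vb_vinvol (hom_vb_rels VB_R (idfun : {multiplicative presented R -> presented R})).
have qR u w : R u w -> word_eval q u = word_eval q w.
  have lt1 (i : 'I_2.-1) : i = 0%N :> nat by case: i => -[].
  move=> /R_UVB; case=> {u w} [_ _ [_ _ []|]|]; try by [move=> i j; rewrite !lt1 | move=> i j; rewrite /far !lt1].
  by move=> i; rewrite /word_eval !big_cons !big_nil mulg1 /= v2.
pose phi : {multiplicative presented R -> presented R} := hom_of (pres_liftM qR).
have phiE g : phi (pres_gen R g) = q g by apply: (pres_lift_gen qR).
have phis i : phi (pres_gen R (@sigma 2 i)) =
    pres_gen R (@sigma 2 i) * pres_gen R (@virt 2 i) by rewrite phiE.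
have phiv i : phi (pres_gen R (@virt 2 i)) = pres_gen R (@virt 2 i) by rewrite phiE.
exists phi; last by split.
have phiK : phi \o phi =1 idfun.
  apply: (pres_hom_ext (h := phi \o phi) (k := idfun)) => -[] i.
    change (phi (phi (pres_gen R (@sigma 2 i))) = pres_gen R (@sigma 2 i)).
    by rewrite phis gmulfM phis phiv -mulgA v2 mulg1.
  change (phi (phi (pres_gen R (@virt 2 i))) = pres_gen R (@virt 2 i)).
  by rewrite !phiv.
by exists phi.
Qed.

(** With r = v_0 v_1, conjugating the s_i by r gives phi of order dividing 3, because phi fixes r
    and r^3 = 1. It sends the pure element s_0 v_0 to s_1 v_0, which is not pure. *)
Lemma twist3 : exists2 phi : {multiplicative VB 3 -> VB 3}, bijective phi &
  exists2 x, @Defs.piP 3 x = 1 & @Defs.piP 3 (phi x) <> 1.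
Proof.
pose o0 := @Ordinal 2 0 isT; pose o1 := @Ordinal 2 1 isT.
have gr := hom_vb_rels (fun _ _ => id) (idfun : {multiplicative VB 3 -> VB 3}).
pose s (i : 'I_3.-1) := pres_gen (@VB_rel 3) (@sigma 3 i).
pose v (i : 'I_3.-1) := pres_gen (@VB_rel 3) (@virt 3 i).
have v2 i : v i * v i = 1 by apply: (vb_vinvol gr).
have [r rE] : exists r, r = v o0 * v o1 by exists (v o0 * v o1).
have rs : r * s o0 = s o1 * r by rewrite rE [RHS]mulgA; apply: (vb_mixed gr (i := o0) (j := o1) erefl).
have r3 : r * r * r = 1.
  have e : v o0 * v o1 * v o0 = v o1 * v o0 * v o1 := vb_vbraid gr (i := o0) (j := o1) erefl.
  by rewrite rE !mulgA e -!mulgA [v o1 * (v o1 * _)]mulgA v2 mul1g [v o0 * (v o0 * _)]mulgA v2 mul1g v2.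
pose q (g : VBgen 3) : VB 3 := match g with inl i => s i ^ r^-1 | inr i => v i end.
(* This is the mixed relation r s_0 = s_1 r conjugated by r, which leaves r itself unchanged. *)
have key : v o0 * v o1 * s o0 ^ r^-1 = s o1 ^ r^-1 * v o0 * v o1.
  by rewrite -[RHS]mulgA -rE !conjgE invgK [r * (s o0 * _)]mulgA rs -!mulgA mulgV mulVg.
have qR : vb_rels (q \o @sigma 3) (q \o @virt 3).
  have o (i : 'I_3.-1) : i = o0 \/ i = o1.
    by case: i => -[|[|//]] lti; [left|right]; apply: val_inj.
  have nofar (i j : 'I_3.-1) : far i j = false.
    by case: (o i) => ->; case: (o j) => ->.
  split=> [i j e|i j|i j e|i j|i|i j|i j e]; rewrite ?nofar //=.
  - by rewrite -!conjMg; congr (_ ^ _); apply: (vb_braid gr).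
  - exact: (vb_vbraid gr).
  - by move: e; case: (o i) => ->; case: (o j) => -> //= _; apply: key.
move/vb_relsP in qR.
pose phi : {multiplicative VB 3 -> VB 3} := hom_of (pres_liftM qR).
have phiE g : phi (pres_gen _ g) = q g by apply: (pres_lift_gen qR).
have phis i : phi (s i) = r * s i * r^-1 by rewrite phiE /= conjgE invgK mulgA.
have phiv i : phi (v i) = v i by rewrite phiE.
have phir : phi r = r by rewrite rE gmulfM !phiv.
have phiK : phi \o phi \o phi =1 idfun.
  apply: (pres_hom_ext (h := phi \o phi \o phi) (k := idfun)) => -[] i.
    change (phi (phi (phi (s i))) = s i).
    rewrite phis !gmulfM homV !phir phis !gmulfM homV !phir phis.
    by rewrite !mulgA r3 mul1g -!mulgA -!invMg r3 invg1 mulg1.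
  change (phi (phi (phi (v i))) = v i).
  by rewrite !phiv.
exists phi; first by exists (phi \o phi) => x; apply: phiK.
have pM x y : @Defs.piP 3 (x * y) = Defs.piP x * Defs.piP y := gmulfM x y.
exists (s o0 * v o0); first by rewrite pM !piP_gen tau2.
rewrite [phi _]gmulfM phis phiv rs mulgK pM !piP_gen /= => e.
have e' : @tau 3 o1 = @tau 3 o0 by apply: (mulIg (@tau 3 o0)); rewrite e tau2.
by apply: (tau_not_comm (n := 3) (i := o0) (j := o1) erefl); rewrite e'.
Qed.

Theorem theorem2 (n : nat) (hn : 2 <= n) :
  ((is_characteristic (VP n) <-> 4 <= n) /\
   (is_characteristic (KB n) <-> 3 <= n)) /\
  (is_characteristic (WP n) <-> 3 <= n) /\
  (is_characteristic (UVP n) <-> 3 <= n).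
Proof.
have id_R u w (r : VB_rel u w) : VB_rel (n := n) u w := r.
have VB_UVB u w (r : VB_rel u w) : UVB_rel (n := n) u w := UVB_WB (WB_VB r).
have VB_W u w (r : VB_rel u w) : WB_rel (n := n) u w := WB_VB r.
have W_UVB u w (r : WB_rel u w) : UVB_rel (n := n) u w := UVB_WB r.
have id_U u w (r : UVB_rel u w) : UVB_rel (n := n) u w := r.
(* For n = 2, [twist2] sends the pure element s v to s v v = s, whose image is a transposition. *)
have pure2 (R : word (VBgen n) -> word (VBgen n) -> Prop)
    (VB_R : forall u w, VB_rel u w -> R u w) (R_UVB : forall u w, R u w -> UVB_rel u w) :
    is_characteristic (group_kernel (projP R_UVB)) -> 3 <= n.
  move=> /characteristic_kernelP ch; have [//|n2] := ltnP 2 n.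
  have e : n = 2 by lia.
  subst n; have [phi bphi [phis phiv]] := twist2 VB_R R_UVB.
  have /(_ (pres_gen R (@sigma 2 ord0) * pres_gen R (@virt 2 ord0))) := ch phi bphi.
  rewrite (gmulfM (s := phi)) phis phiv !gmulfM projP_s projP_v tau2 mul1g => /(_ erefl).
  by move/tau_neq1.
(* With the forbidden relation the condition is vacuous: no surjection kills all the s_i. *)
have killedW (R : word (VBgen n) -> word (VBgen n) -> Prop) :
    (forall u w, WB_rel u w -> R u w) -> 2 < n ->
    forall f : {multiplicative presented R -> 'S_n}, (forall g, exists x, f x = g) ->
     (forall i, f (pres_gen R (sigma i)) = 1) -> commutator_central f.
  by move=> W_R n3 f fS /(killed_welded W_R n3 fS).
split; [split|split]; split.
- move=> ch; have n3 := pure2 _ id_R VB_UVB ch.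
  rewrite ltn_neqAle n3 andbT; apply/eqP => e; subst n.
  have [phi bphi [x px]] := twist3; apply.
  by move/characteristic_kernelP: ch; apply.
- move=> n4; apply: (pure_characteristic id_R VB_UVB); first by left.
  by move=> f; apply: killed_commutator_central; apply: ltnW.
- move=> /characteristic_kernelP ch; have [//|n2] := ltnP 2 n.
  have e : n = 2 by lia.
  subst n; have [phi bphi [phis phiv]] := twist2 id_R VB_UVB.
  have : @piK 2 (phi (pres_gen _ (@sigma 2 ord0))) = 1 := ch phi bphi _ (piK_gen (@sigma 2 ord0)).
  have pM x y : @piK 2 (x * y) = piK x * piK y := gmulfM x y.
  by rewrite phis pM !piK_gen mul1g => /tau_neq1.
- exact: KB_characteristic.
- exact: (pure2 _ VB_W W_UVB).
- move=> n3; apply: (pure_characteristic VB_W W_UVB); last exact: killedW.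
  by case: (ltnP 3 n) => n4; [left|right; split=> //; lia].
- exact: (pure2 _ VB_UVB id_U).
move=> n3; apply: (pure_characteristic VB_UVB id_U); last exact: killedW.
by case: (ltnP 3 n) => n4; [left|right; split=> //; lia].
Qed.
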